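(* Let $(X,\alpha)$ and $(Y,\beta)$ be Cantor minimal systems and let $\phi:X\to\operatorname{Isom}(\mathbb{T})$ and $\psi:Y\to\operatorname{Isom}(\mathbb{T})$ be continuous maps. The following are equivalent. (1) There exist homeomorphisms $\sigma_n:X\times\mathbb{T}\to Y\times\mathbb{T}$ such that $\sigma_n(\alpha\times\phi)\sigma_n^{-1}$ converges to $\beta\times\psi$ in $\operatorname{Homeo}(Y\times\mathbb{T})$. (2) $PS(\beta)\subset PS(\alpha)$, and one of the following holds: (a) $[o(\psi)]_\beta=0$ and $[o(\phi)]_\alpha=0$; (b) $[o(\psi)]_\beta\neq0$ and there exist $n\in\mathbb{N}$, $f\in C(X,\mathbb{Z})$ and $g\in C(Y,\mathbb{Z})$ such that $2^{n-1}[f]_\alpha=[1_X]_\alpha$, $[f]_\alpha+2K^0(X,\alpha)=[o(\phi)]_\alpha$, $2^{n-1}[g]_\beta=[1_Y]_\beta$ and $[g]_\beta+2K^0(Y,\beta)=[o(\psi)]_\beta$; (c) $[o(\psi)]_\beta\neq0$ and $PS(\beta\times o(\psi))=PS(\beta)$.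
   Context: A Cantor minimal system $(X,\alpha)$ is a Cantor set $X$ with a homeomorphism $\alpha$ having no nontrivial closed invariant subsets. $\mathbb{N}=\{1,2,\dots\}$, $\mathbb{T}=\mathbb{R}/\mathbb{Z}$, $\operatorname{Isom}(\mathbb{T})=\{R_t\}\cup\{R_t\lambda\}$ with $R_t(s)=s+t$, $\lambda(s)=-s$, topologized by uniform convergence. For compact metrizable $Z$, $\operatorname{Homeo}(Z)$ carries the topology of uniform convergence. $\alpha\times\phi$ is $(x,t)\mapsto(\alpha(x),\phi_x(t))$ on $X\times\mathbb{T}$. $o(\phi):X\to\mathbb{Z}_2$ is $0$ at $x$ if $\phi_x$ preserves orientation, $1$ otherwise; $\beta\times o(\psi)$ is the homeomorphism $(y,k)\mapsto(\beta(y),k+o(\psi)(y))$ of $Y\times\mathbb{Z}_2$. $K^0(X,\alpha)=C(X,\mathbb{Z})/\{f-f\circ\alpha^{-1}\}$ with classes $[f]_\alpha$; $K^0(X,\alpha)/2K^0(X,\alpha)$ is identified with $C(X,\mathbb{Z}_2)/\{f-f\circ\alpha^{-1}:f\in C(X,\mathbb{Z}_2)\}$ and $[o(\phi)]_\alpha$ is the class of $o(\phi)$ there (similarly for $\beta,\psi$). For a homeomorphism $\gamma$ of a compact space $Z$, $PS(\gamma)$ is the set of $p\in\mathbb{N}$ such that there is a clopen $U\subset Z$ with $U,\gamma(U),\dots,\gamma^{p-1}(U)$ pairwise disjoint and covering $Z$. *)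

(* Defs.v *)
From HB Require Import structures.
From mathcomp Require Import all_boot all_order all_algebra.
From mathcomp Require Import all_classical all_reals all_analysis.
Set Implicit Arguments. Unset Strict Implicit. Unset Printing Implicit Defensive.
Import Order.TTheory GRing.Theory Num.Theory.
Import numFieldNormedType.Exports.
Local Open Scope classical_set_scope.
Local Open Scope ring_scope.

(* The circle T = R/Z, realised as the unit circle of R^2 via
   s |-> (cos 2 pi s, sin 2 pi s); it carries the (pseudo)metric/uniform
   structure of a subspace of R * R. *)
Definition circle_set (R : realType) : set (R * R)%type :=
  [set p | p.1 ^+ 2 + p.2 ^+ 2 = 1].
Notation Tcirc R := (set_type (@circle_set R)).

Definition is_rot (R : realType) (t : R) (f : Tcirc R -> Tcirc R) : Prop :=
  forall p : Tcirc R,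
    set_val (f p) = (cos (2 * pi * t) * (set_val p).1 - sin (2 * pi * t) * (set_val p).2,
                     sin (2 * pi * t) * (set_val p).1 + cos (2 * pi * t) * (set_val p).2).

(* f is R_t \o lambda, with lambda : s |-> -s, i.e. (x,y) |-> (x,-y) *)
Definition is_rotrefl (R : realType) (t : R) (f : Tcirc R -> Tcirc R) : Prop :=
  forall p : Tcirc R,
    set_val (f p) = (cos (2 * pi * t) * (set_val p).1 + sin (2 * pi * t) * (set_val p).2,
                     sin (2 * pi * t) * (set_val p).1 - cos (2 * pi * t) * (set_val p).2).

Definition isomT (R : realType) (f : Tcirc R -> Tcirc R) : Prop :=
  exists t : R, is_rot t f \/ is_rotrefl t f.

(* o(phi)(x) = 0 (false) iff phi_x preserves orientation, i.e. is a rotation *)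
Definition orient (R : realType) (X : Type) (phi : X -> Tcirc R -> Tcirc R)
  (x : X) : bool := ~~ `[< exists t : R, is_rot t (phi x) >].

Definition homeo_pair (A B : topologicalType) (f : A -> B) (g : B -> A) : Prop :=
  [/\ continuous f, continuous g, cancel f g & cancel g f].

(* Cantor set: nonempty, compact, Hausdorff, perfect, zero-dimensional
   (metrizability is provided by the pseudoMetricType structure) *)
Definition cantor_set (T : topologicalType) : Prop :=
  cantor_like T /\ [set: T] !=set0.

Definition minimal (X : topologicalType) (a : X -> X) : Prop :=
  forall A : set X, closed A -> a @` A = A -> A = set0 \/ A = setT.

Definition cantor_minimal (X : topologicalType) (a ai : X -> X) : Prop :=
  [/\ cantor_set X, homeo_pair a ai & minimal a].

(* continuous maps into a discrete space (Z or Z_2) *)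
Definition locconst (X : topologicalType) (V : Type) (f : X -> V) : Prop :=
  forall x, \forall y \near x, f y = f x.

Definition skewprod (R : realType) (X : Type) (a : X -> X)
  (phi : X -> Tcirc R -> Tcirc R) : X * Tcirc R -> X * Tcirc R :=
  fun z => (a z.1, phi z.1 z.2).

Definition skewprod2 (R : realType) (Y : Type) (b : Y -> Y)
  (psi : Y -> Tcirc R -> Tcirc R) : Y * bool -> Y * bool :=
  fun z => (b z.1, z.2 (+) orient psi z.1).

(* [f]_alpha = 0 in K^0(X,alpha) = C(X,Z)/{h - h o alpha^-1} *)
Definition cob_int (X : topologicalType) (ai : X -> X) (f : X -> int) : Prop :=
  exists h : X -> int, locconst h /\ forall x, f x = h x - h (ai x).

(* class of u is 0 in C(X,Z_2)/{h - h o alpha^-1 : h in C(X,Z_2)} *)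
Definition cob_bool (X : topologicalType) (ai : X -> X) (u : X -> bool) : Prop :=
  exists h : X -> bool, locconst h /\ forall x, u x = h x (+) h (ai x).

Definition PS (Z : topologicalType) (g : Z -> Z) : set nat :=
  [set p | (0 < p)%N /\
    exists U : set Z, [/\ clopen U,
      (forall i j, (i < j)%N -> (j < p)%N -> iter i g @` U `&` iter j g @` U = set0) &
      (forall z, exists2 i, (i < p)%N & (iter i g @` U) z)]].

(* Main.v *)
Require Import Defs.
From HB Require Import structures.
From mathcomp Require Import all_boot all_order all_algebra.
From mathcomp Require Import zify ring lra.
From mathcomp Require Import all_classical all_reals all_analysis.

(** A homeomorphism of [X * T] onto [Y * T] permutes the circles, so it induces
    a homeomorphism [t] of the bases; comparing orientations of circle maps,
    condition (1) amounts to finding such [t] with [t a t^-1] close to [b] and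
    [o(psi) \o t] cohomologous to [o(phi)] ([approx_conj]).  Conversely, given
    [t], the remaining rotation parts can be matched approximately because
    every circle-valued function is nearly a twisted coboundary over tall
    Kakutani-Rokhlin towers.

    On the base, a fine clopen partition of [Y] turns [b] into a strongly
    connected finite graph, and [t] into a coding of the towers of [X] by closed
    walks of prescribed length and orientation label.  Such walks exist exactly
    when the lengths satisfy a congruence modulo the period of the graph, or of
    its two-point extension by [o(psi)].  These periods belong to [PS b] and
    [PS (b * o(psi))], and the three cases of (2) are the ways in which the
    congruences can be met.  Orientation is read off from the sign of the
    determinant of the images of three points of the circle, which is constant
    along positively ordered triples. *)

Set Implicit Arguments.
Unset Strict Implicit.
Unset Printing Implicit Defensive.
Import Order.TTheory GRing.Theory Num.Theory.
Import numFieldNormedType.Exports.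
Local Open Scope classical_set_scope.
Local Open Scope ring_scope.

(** * Walks in strongly connected finite graphs *)

(** The powers of two in case (b) come from the exchange of the two sheets of the extension by
    [o(psi)]. This exchange commutes with the extension, so it shifts an eigenfunction modulo [p] by
    a constant [c] with [2c = 0] modulo [p]. If [c = 0], the eigenfunction descends to [b].
    Otherwise [p = 2c], and one minus the increment of the eigenfunction along [b], divided by [c],
    is an integer-valued function with parity [o(psi)]. Multiplying it by the odd part of [c]
    preserves that parity, and what is left of [c] is the power of two. Conversely, when the
    extended graph has period [2c] and the sheets differ by [c], a closed walk has length [jc] with
    label the parity of [j]; a root [[f]] of [[1_X]] forces this same relation on the towers of [X].

    An approximate conjugacy can be made exact on any prescribed locally constant function.
    Eigenfunctions and transfer functions are therefore added to the data it must respect, and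
    congruences and cohomologies then pass between [X] and [Y] without error. *)

Section Walks.
Local Open Scope nat_scope.
Variables (T : finType) (E : rel T).

(** The list [S] holds edges that must be traversed. A coding of [X] that uses every edge of the
    graph of [Y] leaves no cell of [Y] without a partner. *)
Definition walk (l : nat) (v w : T) (S : seq (T * T)) : Prop :=
  exists p : nat -> T, [/\ p 0 = v, p l = w,
    forall i, i < l -> E (p i) (p i.+1) &
    forall e, e \in S -> exists2 i, i < l & (p i, p i.+1) = e].

Lemma walk0 v : walk 0 v v [::].
Proof. by exists (fun=> v). Qed.

Lemma walk1 v w : E v w -> walk 1 v w [:: (v, w)].
Proof.
move=> Evw; exists (fun i => if i is 0 then v else w); split => //.
  by case.
by move=> e; rewrite inE => /eqP ->; exists 0.
Qed.

Lemma walk_cat l1 l2 u v w S1 S2 :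
  walk l1 u v S1 -> walk l2 v w S2 -> walk (l1 + l2) u w (S1 ++ S2).
Proof.
move=> [p [p0 pl pE pS]] [q [q0 ql qE qS]].
pose r i := if i < l1 then p i else q (i - l1).
have r1 i : i <= l1 -> r i = p i.
  rewrite /r leq_eqVlt => /orP[/eqP->|->//]; by rewrite ltnn subnn q0 pl.
have r2 i : r (l1 + i) = q i.
  by rewrite /r ltnNge leq_addr /= addKn.
exists r; split.
- by rewrite r1.
- by rewrite r2.
- move=> i il; have [il1|il1] := ltnP i l1; first by rewrite !r1 ?pE // ltnW.
  rewrite -(subnKC il1) -addnS !r2; apply: qE; lia.
- move=> e; rewrite mem_cat => /orP[/pS[i il <-]|/qS[i il <-]].
    by exists i; [lia | rewrite !r1 // ltnW].
  by exists (l1 + i); [lia | rewrite -addnS !r2].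
Qed.

Lemma walk_nil l v w S : walk l v w S -> walk l v w [::].
Proof. by move=> [p [p0 pl pE _]]; exists p; split. Qed.

Lemma connect_walk v w : connect E v w -> exists l, walk l v w [::].
Proof.
move/connectP => [p]; elim: p v => [|x p IH] v /=.
  by move=> _ ->; exists 0; exact: walk0.
move=> /andP[Evx /IH h] /h [l lw]; exists (1 + l).
exact: (walk_cat (walk_nil (walk1 Evx)) lw).
Qed.

Lemma walk_congr (D : nat) (f : T -> nat) :
  (forall v w, E v w -> f w = f v + 1 %[mod D]) ->
  forall l v w S, walk l v w S -> f w = f v + l %[mod D].
Proof.
move=> fE l v w S [p [<- <- pE _]] {v w S}.
elim: l pE => [|l IH] pE; first by rewrite addn0.
rewrite (fE _ _ (pE l (ltnSn l))) -modnDml IH ?modnDml; last first.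
  by move=> i il; apply: pE; apply: ltnW.
by rewrite addn1 addnS.
Qed.

Hypothesis Econ : forall v w, connect E v w.

Lemma walk_tour v S : (forall e, e \in S -> E e.1 e.2) ->
  exists l, walk l v v S.
Proof.
elim: S => [_|[x y] S IH SE]; first by exists 0; exact: walk0.
have [l1 w1] := connect_walk (Econ v x).
have [l2 w2] := connect_walk (Econ y v).
have [l3 w3] : exists l, walk l v v S.
  by apply: IH => e eS; apply: SE; rewrite inE eS orbT.
have Exy : E x y by apply: (SE (x, y)); rewrite inE eqxx.
by eexists; exact: (walk_cat w1 (walk_cat (walk1 Exy) (walk_cat w2 w3))).
Qed.

End Walks.

(** * Additive sets of natural numbers *)

Section AdditiveSets.
Local Open Scope nat_scope.

(** Here [D] is the least positive difference of two elements of [L]; both [m] and [m + D] in [L]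
    then serve as building blocks for all large multiples of [D]. *)
Lemma additive_set_multiples (L : nat -> Prop) : L 0 ->
  (forall i j, L i -> L j -> L (i + j)) -> (exists2 i, 0 < i & L i) ->
  exists D K, [/\ 0 < D, forall l, L l -> D %| l &
    forall l, K <= l -> D %| l -> L l].
Proof.
move=> L0 LD [i0 i0p Li0].
have LM n i : L i -> L (n * i).
  by move=> Li; elim: n => [|n IH]; rewrite ?mul0n // mulSn; apply: LD.
pose P d := `[< 0 < d /\ exists m, L m /\ L (m + d) >].
have exP : exists d, P d by exists i0; apply/asboolP; split => //; exists 0.
case: (ex_minnP exP) => D /asboolP[Dp [m [Lm LmD]]] Dmin.
have Ddiv l : L l -> D %| l.
  move=> Ll; rewrite /dvdn; have [//|rp] := posnP (l %% D).
  (* With [r] the remainder and [q] the quotient of [l], both [q(m + D)] and [q(m + D) + r = l + qm]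
     lie in [L], so a positive [r] would be a smaller difference. *)
  have : P (l %% D).
    apply/asboolP; split => //; exists ((l %/ D) * (m + D)); split; first exact: LM.
    have -> : l %/ D * (m + D) + l %% D = l + (l %/ D) * m.
      by rewrite {3}(divn_eq l D); lia.
    by apply: LD => //; apply: LM.
  by move/Dmin; rewrite leqNgt ltn_pmod.
have [t mt] := dvdnP (Ddiv _ Lm).
(* Write [m = tD], [l = nD] and [n = ut + v] with [v < t]. Then [l] is [u - v] copies of [m] plus
   [v] copies of [m + D]; the threshold guarantees [v <= u]. *)
exists D, (t * t.+1 * D); split => // l lK /dvdnP[n ln].
have nt : t * t.+1 <= n by rewrite ln leq_pmul2r in lK.
have [t0|tp] := posnP t.
  rewrite ln; apply: LM; by move: LmD; rewrite mt t0.
have -> : l = (n %/ t - n %% t) * m + (n %% t) * (m + D).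
  have lt_nt := ltn_pmod n tp.
  have : n %% t <= n %/ t by rewrite leq_divRL //; nia.
  move/subnK => hk.
  rewrite mulnDr addnA -mulnDl hk ln mt {1}(divn_eq n t); lia.
by apply: LD; apply: LM.
Qed.

End AdditiveSets.

(** * The period of a strongly connected graph *)

Section Period.
Local Open Scope nat_scope.
Variables (T : finType) (E : rel T).
Hypothesis Econ : forall v w, connect E v w.
Hypothesis Eout : forall v, exists w, E v w.

(** [D] is the period of the set of return times to [v0], and [f v] is the length of a chosen walk
    from [v0] to [v]. Completing walks to loops at [v0] shows that lengths modulo [D] depend only on
    the endpoints. *)
Lemma strongly_connected_period (v0 : T) : exists (D K : nat) (f : T -> nat),
  [/\ 0 < D, forall v w, E v w -> f w = f v + 1 %[mod D] &
    forall v w l, K <= l -> f w = f v + l %[mod D] ->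
      walk E l v w [seq e <- enum {: T * T} | E e.1 e.2]].
Proof.
pose L l := walk E l v0 v0 [::].
have [D [K0 [Dp LD DL]]] : exists D K, [/\ 0 < D, forall l, L l -> D %| l &
    forall l, K <= l -> D %| l -> L l].
  apply: additive_set_multiples; first exact: walk0.
    by move=> i j Li Lj; apply: (walk_cat Li Lj).
  have [w Ew] := Eout v0.
  have [l lw] := connect_walk (Econ w v0).
  by exists (1 + l) => //; apply: (walk_cat (walk_nil (walk1 Ew)) lw).
have /choice [f fP] : forall v, exists l, walk E l v0 v [::].
  by move=> v; apply: connect_walk.
have /choice [g gP] : forall v, exists l, walk E l v v0 [::].
  by move=> v; apply: connect_walk.
set S := [seq e <- _ | _].
have [t tP] : exists t, walk E t v0 v0 S.
  by apply: walk_tour => // e; rewrite mem_filter => /andP[].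
have fg v : D %| f v + g v by apply: LD; apply: (walk_cat (fP v) (gP v)).
have Dt : D %| t by apply: LD; apply: walk_nil tP.
pose M := \max_v (g v + f v).
(* This leaves room to go from [v] to [v0], tour all edges in [t] steps, loop at [v0] for at least
   [K0] steps, and go on to [w]. *)
exists D, (K0 + t + M + M), f; split => //.
  move=> v w Evw.
  have h : D %| f v + 1 + g w.
    apply: LD; apply: (walk_cat (walk_cat (fP v) (walk_nil (walk1 Evw))) (gP w)).
  apply/eqP; rewrite -(eqn_modDr (g w)); move: h (fg w); rewrite /dvdn => /eqP-> /eqP->.
  by [].
move=> v w l lK fl.
have Mv : g v + f v <= M by rewrite /M (bigD1 v) //= leq_maxl.
have Mw : g w + f w <= M by rewrite /M (bigD1 w) //= leq_maxl.
have lE : l = g v + (t + (l - g v - t - f w) + f w) by lia.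
rewrite lE -[S]cats0 -[S ++ _]cat0s.
apply: walk_cat (gP v) _.
apply: walk_cat (fP w).
rewrite -[S]cats0; apply: walk_cat tP _.
apply: DL; first lia.
set r := l - _ - _ - _ in lE *.
have : f w + g v = f v + l + g v %[mod D].
  by apply/eqP; rewrite eqn_modDr; apply/eqP.
rewrite {1}lE => h.
have {h} : f w + g v + 0 = f w + g v + (r + (f v + g v + t)) %[mod D].
  by rewrite addn0 h; congr (_ %% _); lia.
move/eqP; rewrite eqn_modDl mod0n eq_sym => /eqP h.
rewrite -(dvdn_addl (n := f v + g v + t)) //; last by apply: dvdn_add.
by apply/eqP.
Qed.

End Period.

(** * Locally constant functions *)

Section LocallyConstant.
Variable X : topologicalType.

Lemma locconst_cst (V : Type) (v : V) : @locconst X V (fun=> v).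
Proof. by move=> x; apply: nearW. Qed.

Lemma locconst_fun (V W : Type) (F : V -> W) (f : X -> V) :
  locconst f -> locconst (fun x => F (f x)).
Proof. by move=> lf x; apply: filterS (lf x) => y ->. Qed.

Lemma locconst_comp (Y : topologicalType) (V : Type) (g : Y -> X) (f : X -> V) :
  continuous g -> locconst f -> locconst (fun y => f (g y)).
Proof. by move=> cg lf y; exact: (cg y _ (lf (g y))). Qed.

Lemma locconst_pair (V W : Type) (f : X -> V) (g : X -> W) :
  locconst f -> locconst g -> locconst (fun x => (f x, g x)).
Proof. by move=> lf lg x; apply: filterS2 (lf x) (lg x) => y -> ->. Qed.

Lemma locconst_fun2 (V W Z : Type) (F : V -> W -> Z) (f : X -> V) (g : X -> W) :
  locconst f -> locconst g -> locconst (fun x => F (f x) (g x)).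
Proof. by move=> lf lg x; apply: filterS2 (lf x) (lg x) => y -> ->. Qed.

Lemma locconst_clopen (V : Type) (P : V -> Prop) (f : X -> V) :
  locconst f -> clopen [set x | P (f x)].
Proof.
move=> lf; split.
  by rewrite openE => x /= Pfx; apply: filterS (lf x) => y /= ->.
rewrite -openC openE => x /= Pfx.
by apply: filterS (lf x) => y /= ->.
Qed.

Lemma clopen_locconst (U : set X) : clopen U -> locconst (fun x => `[< U x >]).
Proof.
move=> [oU cU] x; have [Ux|nUx] := pselect (U x).
  move: oU; rewrite openE => /(_ _ Ux); apply: filterS => y Uy.
  by apply/asbool_equiv_eq; split.
move: cU; rewrite -openC openE => /(_ _ nUx); apply: filterS => y Uy.
by apply/asbool_equiv_eq; split.
Qed.

Lemma continuous_iter (g : X -> X) : continuous g -> forall n, continuous (iter n g).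
Proof.
move=> cg; elim => [|n IH] x; first exact: cvg_id.
by apply: (@continuous_comp _ _ _ (iter n g) g); [exact: IH|exact: cg].
Qed.

Lemma locconst_map (I : Type) (s : seq I) (V : Type) (f : I -> X -> V) :
  (forall i, locconst (f i)) -> locconst (fun x => map (fun i => f i x) s).
Proof.
move=> lf; elim: s => [|i s IH]; first exact: locconst_cst.
exact: (locconst_fun2 cons (lf i) IH).
Qed.

Lemma locconst_all (V : Type) (K : nat) (f : nat -> X -> V) :
  (forall i, locconst (f i)) ->
  forall x, \forall y \near x, forall i, (i < K)%N -> f i y = f i x.
Proof.
move=> lf; elim: K => [|K IH] x; first exact: nearW.
apply: filterS2 (IH x) (lf K x) => y h e i.
by rewrite ltnS leq_eqVlt => /orP[/eqP->//|/h].
Qed.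

Hypothesis cX : compact [set: X].

Lemma compact_finite_subcover (U : X -> set X) : (forall x, nbhs x (U x)) ->
  exists s : seq X, forall x, exists2 c, c \in s & U c x.
Proof.
move=> nU.
(* The filter of finite lists ordered by inclusion: near-covering compactness along it yields one
   list that serves all points. *)
pose F : set_system (seq X) :=
  filter_from setT (fun s0 : seq X => [set s : seq X | {subset s0 <= s}]).
have FF : Filter F.
  apply: filter_from_filter; first by exists [::].
  move=> s t _ _; exists (s ++ t) => // r sr; split => x xs; apply: sr.
    by rewrite mem_cat xs.
  by rewrite mem_cat xs orbT.
have [|s0 _ hs] := (iffLR (compact_near_coveringP _) cX) _ F
    (fun s x => exists2 c, c \in s & U c x) FF.
  move=> x _; exists (U x, [set s : seq X | x \in s]).
    by split => //; exists [:: x] => // s; apply; rewrite inE.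
  by move=> [y s] /= [Uy xs]; exists x.
by exists s0 => x; exact: (hs s0 (fun=> id) x I).
Qed.

Lemma locconst_range (V : eqType) (f : X -> V) : locconst f ->
  exists s : seq V, [/\ uniq s, forall x, f x \in s &
    forall v, v \in s -> exists x, f x = v].
Proof.
move=> lf.
have [s Dcov] := compact_finite_subcover lf.
exists (undup (map f s)); split.
- exact: undup_uniq.
- move=> x; rewrite mem_undup; have [c cD ->] := Dcov x.
  by apply: map_f.
- by move=> v; rewrite mem_undup => /mapP[x _ ->]; exists x.
Qed.

Lemma locconst_partition (V : Type) (f : X -> V) : locconst f ->
  exists n (Q : X -> 'I_n), [/\ locconst Q, forall i, exists x, Q x = i &
    forall x y, Q x = Q y -> f x = f y].
Proof.
move=> lf; have [s [us fs sf]] := @locconst_range {classic V} f lf.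
have idx x : (@index {classic V} (f x) s < size s)%N by rewrite index_mem.
exists (size s), (fun x => Ordinal (idx x)); split.
- move=> x; apply: filterS (lf x) => y e; apply: val_inj => /=.
  by rewrite e.
- move=> i; have [v _] : exists v : {classic V}, True.
    case: s {us fs sf idx} i => [[]//|v s] i; by exists v.
  have [x fx] := sf (nth v s i) (mem_nth _ (ltn_ord i)).
  by exists x; apply: val_inj => /=; rewrite fx index_uniq.
- move=> x y [e].
  by rewrite -(@nth_index {classic V} (f x) (f x) s) // e nth_index.
Qed.

Hypothesis hX : hausdorff_space X.
Hypothesis zX : zero_dimensional X.

Lemma nbhs_clopen (x : X) (A : set X) : nbhs x A ->
  exists U, [/\ clopen U, U x & U `<=` A].
Proof.
by move=> /(zero_dimensional_cvg hX zX cX)[U [Ux cU] UA]; exists U.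
Qed.

(** Zero-dimensionality turns local validity into a global locally constant choice: cover [X] by
    finitely many clopen sets with a valid value on each, and let [x] use the first one that
    contains it. *)
Lemma locconst_select (V : Type) (P : X -> V -> Prop) :
  (forall x : X, exists v, \forall y \near x, P y v) ->
  exists f : X -> V, locconst f /\ forall x, P x (f x).
Proof.
move=> hP.
have /choice [vU vUP] : forall x, exists vU : V * set X,
    [/\ clopen vU.2, vU.2 x & forall y, vU.2 y -> P y vU.1].
  by move=> x; have [v /nbhs_clopen [U [cU Ux UP]]] := hP x; exists (v, U).
have [s Dcov] : exists s : seq X, forall x, exists2 c, c \in s & (vU c).2 x.
  apply: compact_finite_subcover => x; have [[oU _] Ux _] := vUP x.
  exact: open_nbhs_nbhs.
pose m x := [seq `[< (vU c).2 x >] | c <- s].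
have lm : locconst m.
  by apply: locconst_map => c; apply: clopen_locconst; have [] := vUP c.
pose k x := find id (m x).
have ks x : (k x < size s)%N.
  rewrite -(size_map (fun c => `[< (vU c).2 x >])) -has_find has_map.
  have [c cD cx] := Dcov x; apply/hasP; exists c => //=.
  by apply/asboolP.
pose f x := (vU (nth x s (k x))).1; exists f; split.
  move=> x; apply: filterS (lm x) => y e.
  by rewrite /f /k e; congr (vU _).1; apply: set_nth_default; apply: ks.
move=> x; rewrite /f; have [_ _ ] := vUP (nth x s (k x)); apply.
have : nth false (m x) (k x).
  apply: (@nth_find _ false id); rewrite has_find; have := ks x.
  by rewrite /k size_map.
by rewrite (nth_map x) // => /asboolP.
Qed.

End LocallyConstant.

(** * Minimal homeomorphisms and Kakutani-Rokhlin towers *)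

Section Iterates.
Variables (X : Type) (a ai : X -> X).
Hypotheses (aK : cancel a ai) (aiK : cancel ai a).

Lemma iter_can n : cancel (iter n a) (iter n ai).
Proof. by elim: n => [//|n IH] x; rewrite iterSr iterS /= aK IH. Qed.

Lemma iter_can_le i j x : (i <= j)%N -> iter i ai (iter j a x) = iter (j - i) a x.
Proof. by move=> ij; rewrite -{1}(subnKC ij) iterD iter_can. Qed.

End Iterates.

Section Minimal.
Variables (X : topologicalType) (a ai : X -> X).
Hypothesis mX : cantor_minimal a ai.

Let cX : compact [set: X]. Proof. by case: mX => -[[]]. Qed.
Let hX : hausdorff_space X. Proof. by case: mX => -[[]]. Qed.
Let zX : zero_dimensional X. Proof. by case: mX => -[[]]. Qed.
Let ca : continuous a. Proof. by case: mX => _ []. Qed.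
Let cai : continuous ai. Proof. by case: mX => _ []. Qed.
Let aK : cancel a ai. Proof. by case: mX => _ []. Qed.
Let aiK : cancel ai a. Proof. by case: mX => _ []. Qed.

Lemma cantor_minimal_sym : cantor_minimal ai a.
Proof.
case: mX => h _ m; split => //.
move=> A cA aA; apply: m => //.
apply/seteqP; split=> [x []|x Ax].
  by move=> y; rewrite -{1}aA => -[z Az <-] <-; rewrite aiK.
by exists (ai x); [rewrite -aA; exists x | exact: aiK].
Qed.

(* The omega-limit set of a point of [A] is closed, invariant and inside [A]. *)
Lemma closed_forward_invariant (A : set X) : closed A -> A !=set0 ->
  (forall x, A x -> A (a x)) -> A = setT.
Proof.
move=> cA [x Ax] Aa.
pose F := (fun n => iter n a x) @ \oo.
have FF : ProperFilter F by apply: fmap_proper_filter; exact: eventually_filter.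
pose B := cluster F.
have FA : F A.
  by exists 0%N => // n _ /=; elim: n => [//|n IH]; rewrite iterS; apply: Aa.
have BA : B `<=` A.
  move=> z; rewrite /B clusterE => /(_ A FA).
  by rewrite -(iffLR (closure_id A) cA).
have [z [_ Bz]] : [set: X] `&` B !=set0 by apply: cX; exact: filterT.
have cB : closed B.
  by rewrite /B clusterE; apply: closed_bigI => P _; exact: closed_closure.
have Ba y : B y -> B (a y).
  move=> By P Q FP Qay.
  have [|w [/= Pw Qw]] := By [set w | P (a w)] [set w | Q (a w)] _ (ca Qay).
    move: FP => [N _ NP]; exists N => // n /= Nn.
    by rewrite -iterS; apply: NP; rewrite /= leqW.
  by exists (a w).
have Bai y : B y -> B (ai y).
  move=> By P Q FP Qay.
  have [|w [/= Pw Qw]] := By [set w | P (ai w)] [set w | Q (ai w)] _ (cai Qay).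
    move: FP => [N _ NP]; exists N.+1 => // -[//|n] /= Nn.
    by rewrite aK; apply: NP.
  by exists (ai w).
have [_ _ /(_ B cB)[]] := mX.
- apply/seteqP; split => [_ [y By <-]|y By]; first exact: Ba.
  by exists (ai y); [exact: Bai | rewrite aiK].
- by move=> B0; move: Bz; rewrite B0.
- by move=> BT; apply/seteqP; split => // y _; apply: BA; rewrite BT.
Qed.

Lemma open_visited (W : set X) : open W -> W !=set0 ->
  forall x, exists n, W (iter n a x).
Proof.
move=> oW [w Ww] x; apply: contrapT => nW.
pose A := [set x | forall n, ~ W (iter n a x)].
have AT : A = setT.
  apply: closed_forward_invariant.
  - have -> : A = \bigcap_(n in setT) (iter n a @^-1` (~` W)).
      by apply/seteqP; split => y h n; [move=> _; exact: h|exact: (h n I)].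
    apply: closed_bigI => n _.
    by apply: preimage_closed; [move=> ? _; exact: continuous_iter|rewrite closedC].
  - by exists x => n Wn; apply: nW; exists n.
  - by move=> y Ay n; rewrite -iterSr; exact: Ay.
by have : A w; [rewrite AT | move=> /(_ 0%N)].
Qed.

(** A periodic orbit is finite, closed and forward invariant, hence the whole space, and a point of
    a finite Hausdorff space is isolated. *)
Lemma minimal_aperiodic x n : (0 < n)%N -> iter n a x <> x.
Proof.
move=> n0 nx.
pose A : set X := [set` [seq iter i a x | i <- iota 0 n]].
have fin (s : seq X) : closed [set` s].
  by apply: compact_closed => //; apply: finite_compact; exact: finite_seq.
have AT : A = setT.
  apply: closed_forward_invariant; first exact: fin.
  - by exists x; rewrite /A /=; apply/mapP; exists 0%N => //; rewrite mem_iota.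
  - move=> y /mapP[i]; rewrite mem_iota /= add0n => il ->.
    apply/mapP; have [il1|il1] := ltnP i.+1 n.
      by exists i.+1 => //; rewrite mem_iota.
    exists 0%N; rewrite ?mem_iota //= -iterS.
    by have -> : i.+1 = n by apply/eqP; rewrite eqn_leq il1 il.
have [[[/perfectTP /(_ x) px _ _ _] _] _ _] := mX; apply: px.
have -> : [set x] = ~` [set` [seq y <- [seq iter i a x | i <- iota 0 n] | y != x]].
  apply/seteqP; split => [_ ->|y] /=; first by rewrite mem_filter eqxx.
  rewrite mem_filter => /negP; rewrite negb_and negbK => /orP[/eqP//|].
  by move=> /negP nA; exfalso; apply: nA; have : A y by rewrite AT.
by rewrite openC.
Qed.

End Minimal.

(** * Return times and functions defined along towers *)

Section Towers.
Variables (X : topologicalType) (a ai : X -> X).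
Hypothesis mX : cantor_minimal a ai.

Let cX : compact [set: X]. Proof. by case: mX => -[[]]. Qed.
Let hX : hausdorff_space X. Proof. by case: mX => -[[]]. Qed.
Let zX : zero_dimensional X. Proof. by case: mX => -[[]]. Qed.
Let ca : continuous a. Proof. by case: mX => _ []. Qed.
Let cai : continuous ai. Proof. by case: mX => _ []. Qed.
Let aK : cancel a ai. Proof. by case: mX => _ []. Qed.
Let aiK : cancel ai a. Proof. by case: mX => _ []. Qed.

(** By aperiodicity a clopen set separates [x0] from each of its first iterates, so shrinking [W]
    finitely often makes all return times at least [K]. *)
Lemma small_base (V : Type) (F : X -> V) (K : nat) (x0 : X) : locconst F ->
  exists W : set X, [/\ clopen W, W x0, forall x, W x -> F x = F x0 &
    forall x i, (0 < i < K)%N -> W x -> ~ W (iter i a x)].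
Proof.
move=> lF; elim: K => [|K [W [cW Wx0 WF WK]]].
  have [W [cW Wx0 WF]] := nbhs_clopen cX hX zX (lF x0).
  by exists W; split => // x i; rewrite ltn0 andbF.
have [->|K0] := posnP K.
  by exists W; split => // x [|i].
have /(zX)[U [cU Ux0 nU]] : x0 != iter K a x0.
  by apply/eqP => e; exact: (minimal_aperiodic mX K0 (esym e)).
exists (W `&` (U `&` iter K a @^-1` (~` U))); split.
- apply: clopenI => //; apply: clopenI => //; apply: preimage_clopen.
    exact: clopenC.
  exact: continuous_iter.
- by [].
- by move=> x [/WF].
- move=> x i /andP[i0]; rewrite ltnS leq_eqVlt => /orP[/eqP->|iK] [Wx [_ nUx]] [Wi [Ui _]].
    exact: nUx.
  by apply: (WK x i) => //; rewrite i0.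
Qed.

Variable W : set X.
Hypothesis cW : clopen W.
Hypothesis W0 : W !=set0.

Definition returns (x : X) (l : nat) : Prop := [/\ (0 < l)%N, W (iter l a x) &
  forall i, (0 < i < l)%N -> ~ W (iter i a x)].

Lemma returns_exists x : exists l, returns x l.
Proof.
have [n Wn] := open_visited mX cW.1 W0 (a x).
have ex : exists n, `[< W (iter n.+1 a x) >] by exists n; apply/asboolP; rewrite iterSr.
case: (ex_minnP ex) => m /asboolP Wm mmin; exists m.+1; split => // -[//|i] /=.
rewrite ltnS => im Wi.
by have /mmin : `[< W (iter i.+1 a x) >] by [exact/asboolP]; rewrite leqNgt im.
Qed.

(** [j] is the level of [x] in the tower that contains it; it exists because the inverse
    homeomorphism is minimal as well. *)
Lemma last_visit x : exists j, W (iter j ai x) /\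
  forall i, (i < j)%N -> ~ W (iter i ai x).
Proof.
have [n Wn] := open_visited (cantor_minimal_sym mX) cW.1 W0 x.
have ex : exists n, `[< W (iter n ai x) >] by exists n; apply/asboolP.
case: (ex_minnP ex) => m /asboolP Wm mmin; exists m; split => // i im Wi.
by have /mmin : `[< W (iter i ai x) >] by [exact/asboolP]; rewrite leqNgt im.
Qed.

Lemma tower_cover z : exists x l i,
  [/\ W x, returns x l, (i < l)%N & z = iter i a x].
Proof.
have [j [Wj nj]] := last_visit z.
have [l rl] := returns_exists (iter j ai z).
exists (iter j ai z), l, j; split => //; last by rewrite (iter_can aiK).
rewrite ltnNge; apply/negP => lj; have [l0 Wl _] := rl.
move: Wl; rewrite iter_can_le //; apply: nj.
by rewrite ltn_subrL l0 (leq_trans l0 lj).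
Qed.

Lemma locconst_asbool_iter (g : X -> X) i : continuous g ->
  locconst (fun x => `[< W (iter i g x) >]).
Proof.
move=> cg; apply: (@locconst_comp X X bool (iter i g) (fun x => `[< W x >])).
  exact: continuous_iter.
exact: clopen_locconst.
Qed.

Lemma returns_near x l : returns x l -> \forall y \near x, returns y l.
Proof.
move=> [l0 Wl nW].
have := @locconst_all X bool l.+1 (fun i x => `[< W (iter i a x) >])
  (fun i => locconst_asbool_iter i ca) x.
apply: filterS => y h; split => //.
  by apply/asboolP; rewrite (h l (ltnSn l)); apply/asboolP.
move=> i /[dup] /andP[_ il] /nW nWi Wi; apply: nWi.
by apply/asboolP; rewrite -(h i (ltnW il)); apply/asboolP.
Qed.

(** A string chosen locally constantly over the base is written up each tower. Since all strings
    start and end at [v0], the end of one tower agrees with the start of the next, so [q] follows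
    the string up to and including level [l]. *)
Lemma tower_select (T : Type) (v0 : T) (Good : X -> nat -> (nat -> T) -> Prop) :
  (forall x l p, Good x l p -> p 0%N = v0 /\ p l = v0) ->
  (forall x l, W x -> returns x l -> exists p, \forall y \near x, Good y l p) ->
  exists q : X -> T, locconst q /\ forall x l, W x -> returns x l ->
    exists p, Good x l p /\ forall i, (i <= l)%N -> q (iter i a x) = p i.
Proof.
move=> Gv0 exG.
have [pi [lpi piP]] : exists pi : X -> nat -> T, locconst pi /\
    forall x, W x -> exists l, returns x l /\ Good x l (pi x).
  apply: (@locconst_select _ cX hX zX _
    (fun x p => W x -> exists l, returns x l /\ Good x l p)) => x; have [Wx|nWx] := pselect (W x).
    have [l rl] := returns_exists x; have [p pP] := exG x l Wx rl.
    by exists p; apply: filterS2 (returns_near rl) pP => y ? ? _; exists l.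
  exists (fun=> v0); case: cW => _; rewrite -openC openE => /(_ x nWx).
  by apply: filterS.
have /choice [j jP] := last_visit.
have lj : locconst j.
  move=> x; have [Wj nW] := jP x.
  have := @locconst_all X bool (j x).+1 (fun i x => `[< W (iter i ai x) >])
    (fun i => locconst_asbool_iter i cai) x.
  apply: filterS => y h; have [Wy nWy] := jP y.
  have [jj|jj|//] := ltngtP (j y) (j x).
    exfalso; apply: (nW _ jj); apply/asboolP; rewrite -h; last exact: ltnW.
    exact/asboolP.
  exfalso; apply: (nWy _ jj); apply/asboolP; rewrite h //.
  exact/asboolP.
(* Drop [z] to the base of its tower and read the string there at the level of [z]. *)
pose q z := pi (iter (j z) ai z) (j z).
have qW x l i : W x -> returns x l -> (i < l)%N -> q (iter i a x) = pi x i.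
  move=> Wx [l0 Wl nWl] il.
  have ji : j (iter i a x) = i.
    have [Wj nW] := jP (iter i a x).
    have [jj|jj|//] := ltngtP (j (iter i a x)) i.
      exfalso; move: Wj; rewrite iter_can_le; [|exact: aK|exact: ltnW].
      by apply: nWl; rewrite subn_gt0 jj /= (leq_ltn_trans (leq_subr _ _)).
    by exfalso; apply: (nW i jj); rewrite (iter_can aK).
  by rewrite /q ji (iter_can aK).
exists q; split.
  move=> z.
  have := @locconst_comp X X _ (iter (j z) ai) pi (@continuous_iter _ _ cai (j z)) lpi z.
  by apply: filterS2 (lj z) => y ej e; rewrite /q ej e.
move=> x l Wx rl; have [l' [rl' Gx]] := piP x Wx.
have ll : l' = l.
  case: rl rl' => [l0 Wl nl] [l0' Wl' nl'].
  have [h|h|//] := ltngtP l' l; exfalso.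
    by apply: (nl l') => //; rewrite l0'.
  by apply: (nl' l) => //; rewrite l0.
rewrite {}ll in Gx; exists (pi x); split => // i; rewrite leq_eqVlt => /orP[/eqP->|]; last exact: qW.
have [_ ->] := Gv0 _ _ _ Gx.
have [_ Wl _] := rl; have [m [rm Gm]] := piP _ Wl.
have := qW _ m 0%N Wl rm; rewrite /= => ->; last by case: rm.
by case: (Gv0 _ _ _ Gm).
Qed.

End Towers.

(** * Homeomorphisms between Cantor sets *)

Section CantorHomeo.
Variable R : realType.

Lemma cantor_like_homeo (Z : pseudoMetricType R) (z : Z) : cantor_like Z ->
  exists (f : cantor_space -> Z) (g : Z -> cantor_space), homeo_pair f g.
Proof.
move=> h.
pose Zp : pseudoPMetricType R := HB.pack (Z : Type) Z (isPointed.Build Z z).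
have [f [cf clf]] := @homeomorphism_cantor_like R Zp h.
have fK : cancel f (f^-1)%FUN by move=> x; rewrite funK ?inE.
have gK : cancel (f^-1)%FUN f by move=> x; rewrite invK ?inE.
exists f, (f^-1)%FUN; split => //.
apply/continuous_closedP => D /clf; congr closed; apply/seteqP; split.
  by move=> _ [c Dc <-] /=; rewrite fK.
by move=> x /= Dx; exists ((f^-1)%FUN x).
Qed.

Variable X : pseudoMetricType R.
Hypothesis cX : cantor_like X.

Lemma set_type_cantor_like (A : set X) : clopen A -> cantor_like (set_type A).
Proof.
move=> [oA clA]; case: cX => pX kX hX zX.
have cval : continuous (set_val : set_type A -> X) by exact: initial_continuous.
have inA (x : set_type A) : A (set_val x) by exact: set_valP.
split.
- apply/perfectTP => x [U oU Ux].
  have := (perfectTP.1 pX) (set_val x); apply.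
  have -> : [set set_val x] = U `&` A.
    apply/seteqP; split => [_ ->|y [Uy Ay]].
      by split => //; have : (set_val @^-1` U) x by rewrite Ux.
    have : (set_val @^-1` U) (SigSub (mem_set Ay) : set_type A) by [].
    by rewrite Ux /= => <-.
  exact: openI.
- move=> F FF _.
  have FA : (set_val @ F) A by apply: (@filterS _ F _ setT) => //; [move=> x _; exact: inA | exact: filterT].
  have kA : compact A by apply: subclosed_compact kX _.
  have [x [Ax xF]] := kA _ (fmap_proper_filter _ FF) FA.
  exists (SigSub (mem_set Ax)); split => // P Q FP [_ [[U oU <-] Ux UQ]].
  have [|_ [[y Py <-] Uy]] := xF (set_val @` P) U _ (open_nbhs_nbhs (conj oU Ux)).
    by apply: (@filterS _ F _ P) => // y Py; exists y.
  by exists y; split => //; apply: UQ.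
- move=> x y xy; apply: val_inj; apply: hX => P Q nP nQ.
  by have [z [Pz Qz]] := xy _ _ (cval x _ nP) (cval y _ nQ); exists (set_val z).
- move=> x y xy; have [|U [cU Ux Uy]] := zX (set_val x) (set_val y).
    by apply: contra xy => /eqP e; apply/eqP; exact: val_inj.
  by exists (set_val @^-1` U); split => //; exact: preimage_clopen.
Qed.

(** The inverse chart is a total function with an arbitrary value outside [A], whence continuity
    only at points of [A]. *)
Lemma clopen_homeo_cantor (A : set X) : clopen A -> A !=set0 ->
  exists (f : cantor_space -> X) (g : X -> cantor_space),
  [/\ continuous f, forall x, A x -> {for x, continuous g},
      forall c, A (f c), cancel f g & forall x, A x -> f (g x) = x].
Proof.
move=> cA [x0 Ax0].
have [f [g [cf cg fK gK]]] := @cantor_like_homeo (set_type A)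
   (SigSub (mem_set Ax0)) (set_type_cantor_like cA).
pose G x := if pselect (A x) is left h then g (SigSub (mem_set h)) else
  g (SigSub (mem_set Ax0)).
have GE (x : set_type A) : G (set_val x) = g x.
  rewrite /G; case: pselect => [h|[]]; last exact: set_valP.
  by congr g; apply: val_inj.
exists (fun c => set_val (f c)), G; split.
- move=> c; apply: (@continuous_comp _ _ _ f set_val); first exact: cf.
  exact: initial_continuous.
- move=> x Ax N.
  have -> : x = set_val (SigSub (mem_set Ax) : set_type A) by [].
  rewrite GE => /cg [_ [[U oU <-] Ux UN]].
  have nA : nbhs x (U `&` A).
    apply: open_nbhs_nbhs; split; last by split.
    by apply: openI => //; case: cA.
  apply: filterS nA => y [Uy Ay] /=.
  rewrite -[y]/(set_val (SigSub (mem_set Ay) : set_type A)) GE.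
  exact: (UN (SigSub (mem_set Ay))).
- by move=> c; exact: set_valP.
- by move=> c; rewrite GE fK.
- move=> x Ax.
  by rewrite -[x]/(set_val (SigSub (mem_set Ax) : set_type A)) GE gK.
Qed.

End CantorHomeo.

Lemma continuous_near_eq (A B : topologicalType) (h h' : A -> B) (x : A) :
  (\forall y \near x, h y = h' y) -> {for x, continuous h} -> {for x, continuous h'}.
Proof.
move=> e ch N nN; have := ch N; rewrite (nbhs_singleton e) => /(_ nN) nhN.
by apply: filterS2 e nhN => y /= ->.
Qed.

Lemma partition_charts (R : realType) (X : pseudoMetricType R) (V : Type)
    (q : X -> V) : cantor_set X -> locconst q ->
  exists (f : V -> cantor_space -> X) (g : V -> X -> cantor_space),
    forall v, (exists x, q x = v) -> [/\ continuous (f v),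
      forall x, q x = v -> {for x, continuous (g v)},
      forall c, q (f v c) = v, cancel (f v) (g v) &
      forall x, q x = v -> f v (g v x) = x].
Proof.
move=> [cX [x0 _]] lq.
have /choice [F FP] : forall v, exists fg : (cantor_space -> X) * (X -> cantor_space),
    (exists x, q x = v) -> [/\ continuous fg.1,
      forall x, q x = v -> {for x, continuous fg.2},
      forall c, q (fg.1 c) = v, cancel fg.1 fg.2 & forall x, q x = v -> fg.1 (fg.2 x) = x].
  move=> v; have [[x xv]|n] := pselect (exists x, q x = v); last first.
    by exists (fun=> x0, fun=> point).
  have [||f [g fgP]] := @clopen_homeo_cantor R X cX [set x | q x = v].
  - exact: (locconst_clopen (fun w => w = v)).
  - by exists x.
  by exists (f, g).
by exists (fun v => (F v).1), (fun v => (F v).2).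
Qed.

(** Nonempty clopen cells are Cantor sets, so cells with the same name are homeomorphic through
    [cantor_space]; these homeomorphisms glue because the cells are open. *)
Lemma cantor_partition_homeo (R : realType) (X Y : pseudoMetricType R) (V : Type)
    (q : X -> V) (Q : Y -> V) : cantor_set X -> cantor_set Y ->
  locconst q -> locconst Q ->
  (forall x, exists y, Q y = q x) -> (forall y, exists x, q x = Q y) ->
  exists (t : X -> Y) (ti : Y -> X), homeo_pair t ti /\ forall x, Q (t x) = q x.
Proof.
move=> cX cY lq lQ qQ Qq.
have [f [g fgP]] := @partition_charts R X V q cX lq.
have [f' [g' fgP']] := @partition_charts R Y V Q cY lQ.
pose t x := f' (q x) (g (q x) x); pose ti y := f (Q y) (g' (Q y) y).
have Qt x : Q (t x) = q x by have [_ _ h _ _] := fgP' _ (qQ x); exact: h.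
have qti y : q (ti y) = Q y by have [_ _ h _ _] := fgP _ (Qq y); exact: h.
exists t, ti; split => //; split.
- move=> x; apply: (@continuous_near_eq _ _ (fun y => f' (q x) (g (q x) y))).
    by apply: filterS (lq x) => y e; rewrite /t e.
  have [_ cg _ _ _] := fgP (q x) (ex_intro _ x erefl).
  have [cf' _ _ _ _] := fgP' (q x) (qQ x).
  by apply: continuous_comp; [exact: cg | exact: cf'].
- move=> x; apply: (@continuous_near_eq _ _ (fun y => f (Q x) (g' (Q x) y))).
    by apply: filterS (lQ x) => y e; rewrite /ti e.
  have [_ cg _ _ _] := fgP' (Q x) (ex_intro _ x erefl).
  have [cf' _ _ _ _] := fgP (Q x) (Qq x).
  by apply: continuous_comp; [exact: cg | exact: cf'].
- move=> x; rewrite /ti Qt /t.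
  have [_ _ _ _ gf] := fgP (q x) (ex_intro _ x erefl).
  by have [_ _ _ -> _] := fgP' (q x) (qQ x); exact: gf.
- move=> y; rewrite /t qti /ti.
  have [_ _ _ _ gf] := fgP' (Q y) (ex_intro _ y erefl).
  by have [_ _ _ -> _] := fgP (Q y) (Qq y); exact: gf.
Qed.

(** * Cyclic partitions and two-point extensions *)

Lemma locconst_continuous (X Y : topologicalType) (f : X -> Y) :
  locconst f -> continuous f.
Proof.
move=> lf x N nN; have fx := nbhs_singleton nN.
by apply: filterS (lf x) => y /= e; rewrite /= e.
Qed.

Lemma continuous_pair (X Y Z : topologicalType) (f : X -> Y) (g : X -> Z) :
  continuous f -> continuous g -> continuous (fun x => (f x, g x)).
Proof. by move=> cf cg x; apply: cvg_pair; [exact: cf | exact: cg]. Qed.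

Lemma iter_congr (Z : Type) (g : Z -> Z) (p : nat) (theta : Z -> nat) :
  (forall z, theta (g z) = theta z + 1 %[mod p])%N ->
  forall i z, (theta (iter i g z) = theta z + i %[mod p])%N.
Proof.
move=> tg; elim => [|i IH] z; first by rewrite addn0.
by rewrite iterS tg -modnDml IH modnDml addn1 addnS.
Qed.

(** A cyclic clopen partition is the level partition of a continuous eigenfunction into [Z/p]. Using
    [nat] values and congruences lets lengths of walks serve directly as eigenfunctions. *)
Lemma PS_eigenfunction (Z : topologicalType) (g gi : Z -> Z) (p : nat) :
  homeo_pair g gi ->
  PS g p <-> ((0 < p)%N /\ exists theta : Z -> nat, locconst theta /\
    forall z, (theta (g z) = theta z + 1 %[mod p])%N).
Proof.
move=> [cg cgi gK giK]; split; last first.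
  move=> [p0 [theta [lt tg]]]; split => //.
  exists [set z | (theta z = 0 %[mod p])%N]; split.
  - exact: (locconst_clopen (fun m => (m = 0 %[mod p])%N) lt).
  - move=> i j ij jp; apply/seteqP; split => // _ [[u /= u0 <-] [v /= v0 e]].
    have := iter_congr tg i u; rewrite -e (iter_congr tg j v) -modnDml v0 mod0n.
    rewrite -[RHS]modnDml u0 mod0n !add0n !modn_small ?(ltn_trans ij) // => ji.
    by move: ij; rewrite ji ltnn.
  - move=> z; exists (theta z %% p)%N; first by rewrite ltn_pmod.
    exists (iter (theta z %% p) gi z); last by rewrite (iter_can giK).
    have := iter_congr tg (theta z %% p) (iter (theta z %% p) gi z).
    rewrite (iter_can giK) modnDmr => /eqP; rewrite -{1}[theta z]add0n eqn_modDr.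
    by move=> /eqP e /=; rewrite -e.
move=> [p0 [U [cU dU covU]]]; split => //.
have gU i z : (iter i g @` U) (iter i g z) -> U z.
  by move=> [u Uu /(can_inj (iter_can gK i)) <-].
have disj i j z : (i < p)%N -> (j < p)%N ->
    (iter i g @` U) z -> (iter j g @` U) z -> i = j.
  move=> ip jp iz jz; have [ij|ij|//] := ltngtP i j; exfalso.
    by have : (iter i g @` U `&` iter j g @` U) z by []; rewrite dU.
  by have : (iter j g @` U `&` iter i g @` U) z by []; rewrite dU.
have /choice [theta tP] : forall z, exists i, (i < p)%N /\ (iter i g @` U) z.
  by move=> z; have [i ip iz] := covU z; exists i.
have imE i : iter i g @` U = iter i gi @^-1` U.
  apply/seteqP; split => [_ [u Uu <-] /=|z /= Uz]; first by rewrite (iter_can gK).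
  by exists (iter i gi z) => //; rewrite (iter_can giK).
exists theta; split.
  move=> z; have [tp tz] := tP z.
  have : nbhs z (iter (theta z) g @` U).
    rewrite imE; apply: open_nbhs_nbhs; split; last by rewrite -imE.
    by case: (preimage_clopen cU (@continuous_iter _ _ cgi (theta z))).
  apply: filterS => y yU; have [typ ty] := tP y.
  exact: (disj _ _ y).
move=> z; have [tp [u Uu uz]] := tP z; have [tgp tg] := tP (g z).
have [tp1|tp1] := ltnP (theta z).+1 p.
  rewrite addn1; congr (_ %% p)%N; apply: disj tg _ => //.
  by exists u => //; rewrite iterS uz.
(* At the top level the next value must be [0]: if [g z] had level [i.+1], then [z] would have level
   [i], below the top. *)
have tE : (theta z).+1 = p by apply/eqP; rewrite eqn_leq tp1 tp.
rewrite addn1 tE modnn.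
case ti : (theta (g z)) => [|i]; first by rewrite mod0n.
exfalso; move: tg; rewrite ti => -[v Vv /= /(can_inj gK) ez].
have ip : (i.+1 < p)%N by rewrite -ti.
have : i = theta z.
  apply: (disj _ _ z); [exact: ltnW | by [] | by exists v | by exists u].
by move=> iz; move: ip; rewrite iz tE ltnn.
Qed.

Lemma modn_eq_int (m n d : nat) : (m = n %[mod d])%N ->
  exists k : int, m%:Z = n%:Z + k * d%:Z.
Proof.
move=> e; exists ((m %/ d)%N%:Z - (n %/ d)%N%:Z).
have em := divn_eq m d; have en := divn_eq n d; rewrite e in em.
move: {e} em en; move: (m %/ d)%N (n %/ d)%N (n %% d)%N => u v r -> ->.
rewrite !PoszD !PoszM; ring.
Qed.

Lemma int_eq_modn (m n d : nat) (k : int) : m%:Z = n%:Z + k * d%:Z ->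
  (m = n %[mod d])%N.
Proof.
move=> e; apply/eqP; rewrite -eqz_nat -!modz_nat e addrC modzMDl.
by [].
Qed.

Lemma modn_diff (p m n : nat) : (0 < p)%N ->
  exists2 c, (c < p)%N & (m = n + c %[mod p])%N.
Proof.
move=> p0; exists ((m + (p - n %% p)) %% p)%N; first by rewrite ltn_pmod.
rewrite modnDmr -modnDml.
have np : (n %% p < p)%N by rewrite ltn_pmod.
have -> : (n %% p + (m + (p - n %% p)) = m + p)%N by lia.
by rewrite modnDr.
Qed.

(** Convertible to [skewprod2 b psi] when [o] is [orient psi]; the base arguments need only the
    cocycle [o], not the circle maps. *)
Definition skew2 (Y : Type) (b : Y -> Y) (o : Y -> bool) (z : Y * bool) : Y * bool :=
  (b z.1, z.2 (+) o z.1).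

Lemma locconst_prod_bool (Y : topologicalType) (V : Type) (f : Y -> bool -> V) :
  (forall k, locconst (f^~ k)) -> locconst (fun z : Y * bool => f z.1 z.2).
Proof.
move=> lf z.
have l1 : locconst (fun z : Y * bool => (f z.1 true, f z.1 false)).
  apply: (@locconst_comp _ _ _ fst (fun y => (f y true, f y false))).
    by move=> ?; exact: cvg_fst.
  by apply: locconst_pair; exact: lf.
have l2 : locconst (fun z : Y * bool => z.2).
  apply: (@locconst_comp _ _ _ snd id); first by move=> ?; exact: cvg_snd.
  by move=> k; exact: discrete_set1.
by apply: filterS2 (l1 z) (l2 z) => -[y k] /= [e1 e2] ->; case: z.2.
Qed.

(** * Invariant functions and eigenfunctions of two-point extensions *)

Section Skew.
Variables (Y : topologicalType) (b bi : Y -> Y) (o : Y -> bool).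
Hypothesis lo : locconst o.

(** Moving the transfer function by one step of [b] replaces the backward coboundary by a forward
    one, which telescopes along forward orbits. *)
Lemma cob_boolP : homeo_pair b bi -> cob_bool bi o <->
  exists h, locconst h /\ forall y, o y = h y (+) h (b y).
Proof.
move=> [cb cbi bK biK]; split => -[h [lh oh]].
  exists (fun y => h (bi y)); split; first exact: locconst_comp.
  by move=> y; rewrite bK addbC.
exists (fun y => h (b y)); split; first exact: locconst_comp.
by move=> y; rewrite biK addbC.
Qed.

Lemma cob_intP (f : Y -> int) : homeo_pair b bi -> cob_int bi f <->
  exists h, locconst h /\ forall y, f y = h (b y) - h y.
Proof.
move=> [cb cbi bK biK]; split => -[h [lh oh]].
  exists (fun y => h (bi y)); split; first exact: locconst_comp.
  by move=> y; rewrite bK.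
exists (fun y => h (b y)); split; first exact: locconst_comp.
by move=> y; rewrite biK.
Qed.

Lemma skew2_homeo : homeo_pair b bi ->
  homeo_pair (skew2 b o) (fun z => (bi z.1, z.2 (+) o (bi z.1))).
Proof.
move=> [cb cbi bK biK]; split.
- apply: (@continuous_pair _ _ _ (fun z : Y * bool => b z.1)).
    by move=> z; apply: continuous_comp; [exact: cvg_fst | exact: cb].
  apply: (@locconst_continuous _ bool (fun z : Y * bool => z.2 (+) o z.1)).
  apply: (@locconst_prod_bool _ _ (fun y k => k (+) o y)) => k.
  exact: (locconst_fun (addb k)).
- apply: (@continuous_pair _ _ _ (fun z : Y * bool => bi z.1)).
    by move=> z; apply: continuous_comp; [exact: cvg_fst | exact: cbi].
  apply: (@locconst_continuous _ bool (fun z : Y * bool => z.2 (+) o (bi z.1))).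
  apply: (@locconst_prod_bool _ _ (fun y k => k (+) o (bi y))) => k.
  apply: (locconst_fun (addb k)); exact: (locconst_comp cbi).
- by move=> [y k]; rewrite /skew2 /= bK -addbA addbb addbF.
- by move=> [y k]; rewrite /skew2 /= biK -addbA addbb addbF.
Qed.

Hypothesis mY : cantor_minimal b bi.
Hypothesis no : ~ cob_bool bi o.

(* A proper invariant clopen set would meet every fibre in exactly one point,
   and thereby exhibit [o] as a coboundary. *)
Lemma skew2_forward_invariant (A : Y -> bool -> bool) :
  (forall k, locconst (A^~ k)) -> (exists y k, A y k) ->
  (forall y k, A y k -> A (b y) (k (+) o y)) -> forall y k, A y k.
Proof.
move=> lA [y0 [k0 Ayk]] Ab.
have full (S : bool -> bool -> bool) : (exists y, S (A y false) (A y true)) ->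
    (forall y, S (A y false) (A y true) -> S (A (b y) false) (A (b y) true)) ->
    forall y, S (A y false) (A y true).
  move=> S0 Sb y.
  have -> : S (A y false) (A y true) <-> [set y | S (A y false) (A y true)] y by [].
  rewrite (closed_forward_invariant mY (A := [set y | S (A y false) (A y true)])) //.
  by case: (locconst_clopen (fun uv : bool * bool => S uv.1 uv.2)
    (locconst_pair (lA false) (lA true))).
have S1 := full orb _ _; have {}S1 : forall y, A y false || A y true.
  apply: S1; first by exists y0; case: k0 Ayk => ->; rewrite ?orbT.
  by move=> y /orP[] /Ab; case: (o y) => /= ->; rewrite ?orbT.
have [S2|nS2] := pselect (exists y, A y false && A y true).
  have h : forall y, A y false && A y true.
    apply: (full andb) => // y /andP[/Ab h1 /Ab h2].
    by move: h1 h2; case: (o y) => /= -> ->.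
  by move=> y k; have /andP[h1 h2] := h y; case: k.
exfalso; apply: no; apply/cob_boolP; first by case: mY.
exists (fun y => A y true); split; first exact: lA.
have ex y : A y false = ~~ A y true.
  have := S1 y; case e1 : (A y true); case e2 : (A y false) => //.
  by move=> _; exfalso; apply: nS2; exists y; rewrite e1 e2.
move=> y; have := Ab y (A y true); case e : (A y true); rewrite ?e ?ex ?e.
  by move=> /(_ isT); case: (o y) => /=; rewrite ?ex => h; [rewrite (negbTE h)|rewrite h].
by move=> /(_ isT); case: (o y) => /=; rewrite ?ex => h; [rewrite h|rewrite (negbTE h)].
Qed.

Lemma skew2_invariant (V : Type) (u : Y -> bool -> V) :
  (forall k, locconst (u^~ k)) -> (forall y k, u (b y) (k (+) o y) = u y k) ->
  forall y k y' k', u y k = u y' k'.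
Proof.
move=> lu ub y k y' k'.
have := @skew2_forward_invariant (fun z j => `[< u z j = u y' k' >]) _ _ _ y k.
move=> h; apply/asboolP; apply: h.
- by move=> j; apply: (locconst_fun (fun v => `[< v = u y' k' >])); exact: lu.
- by exists y', k'; apply/asboolP.
- by move=> z j /asboolP e; apply/asboolP; rewrite ub.
Qed.

(** Two eigenfunctions with the same modulus differ by an invariant function, hence by a constant;
    the conclusion states this without subtraction. *)
Lemma skew2_eigen_shift (p : nat) (theta theta' : Y -> bool -> nat) : (0 < p)%N ->
  (forall k, locconst (theta^~ k)) -> (forall k, locconst (theta'^~ k)) ->
  (forall y k, theta (b y) (k (+) o y) = theta y k + 1 %[mod p])%N ->
  (forall y k, theta' (b y) (k (+) o y) = theta' y k + 1 %[mod p])%N ->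
  forall y k y' k', (theta y k + theta' y' k' = theta y' k' + theta' y k %[mod p])%N.
Proof.
case: p => // p _ lt lt' tb tb' y k y' k'.
(* The modulus is now [p.+1], for which [p] represents [-1]: the function is the difference
   [theta - theta']. *)
have := @skew2_invariant _ (fun y k => (theta y k + p * theta' y k) %% p.+1)%N _ _ y k y' k'.
move=> h; have {h} : (theta y k + p * theta' y k = theta y' k' + p * theta' y' k' %[mod p.+1])%N.
  apply: h => [j|z j].
    by apply: (locconst_fun2 (fun m n => (m + p * n) %% p.+1)%N); [exact: lt|exact: lt'].
  rewrite -modnDml tb modnDml -modnDmr -modnMmr tb' modnMmr modnDmr.
  have -> : (theta z j + 1 + p * (theta' z j + 1) = (theta z j + p * theta' z j) + p.+1)%N by lia.
  by rewrite modnDr.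
move/eqP; rewrite -(eqn_modDr (theta' y k + theta' y' k')).
have -> : (theta y k + p * theta' y k + (theta' y k + theta' y' k') =
  theta' y k * p.+1 + (theta y k + theta' y' k'))%N by lia.
have -> : (theta y' k' + p * theta' y' k' + (theta' y k + theta' y' k') =
  theta' y' k' * p.+1 + (theta y' k' + theta' y k))%N by lia.
by rewrite !modnMDl => /eqP.
Qed.

(** Exchanging the sheets commutes with the skew product, so it turns [theta] into another
    eigenfunction, a constant shift of [theta]; the exchange is an involution, so twice the shift
    vanishes. *)
Lemma skew2_eigen_flip (p : nat) (theta : Y -> bool -> nat) : (0 < p)%N ->
  (forall k, locconst (theta^~ k)) ->
  (forall y k, theta (b y) (k (+) o y) = theta y k + 1 %[mod p])%N ->
  exists c, [/\ (c < p)%N, forall y, (theta y true = theta y false + c %[mod p])%N &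
    (c + c = 0 %[mod p])%N].
Proof.
move=> p0 lt tb.
have shift y k y' k' : (theta y k + theta y' (~~ k') =
    theta y' k' + theta y (~~ k) %[mod p])%N.
  apply: (@skew2_eigen_shift p theta (fun y k => theta y (~~ k))) => //.
  by move=> z j; rewrite -tb; case: j; case: (o z).
have [_ [y0 _]] : cantor_set Y by case: mY.
have [c cp cE] := modn_diff (theta y0 true) (theta y0 false) p0.
exists c; split => //.
  move=> y; have /eqP := shift y false y0 false; rewrite /= -modnDmr cE modnDmr.
  by rewrite addnCA eqn_modDl => /eqP ->.
have : (theta y0 false + c + (theta y0 false + c) =
    theta y0 false + theta y0 false + 0 %[mod p])%N.
  by rewrite addn0 -modnDm -cE modnDm; exact: (shift y0 true y0 false).
by move/eqP; rewrite addnACA eqn_modDl => /eqP.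
Qed.

End Skew.

(** * Approximate conjugacy on the base *)

(** [F] plays the role of the precision: the conjugacy is required only up to cells of [F].
    Orientations are discrete, so the cohomology between them, with [h] the orientation of the fibre
    maps, is required exactly. *)
Definition approx_conj (X Y : topologicalType) (a : X -> X) (b : Y -> Y)
    (oX : X -> bool) (oY : Y -> bool) : Prop :=
  forall (V : Type) (F : Y -> V), locconst F ->
  exists (t : X -> Y) (ti : Y -> X) (h : X -> bool),
    [/\ homeo_pair t ti, locconst h, forall x, F (b (t x)) = F (t (a x)) &
        forall x, h (a x) (+) oX x = oY (t x) (+) h x].

(** * From approximate conjugacy to condition (2) *)

Section Necessary.
Variables (X Y : topologicalType) (a ai : X -> X) (b bi : Y -> Y).
Variables (oX : X -> bool) (oY : Y -> bool).
Hypotheses (mX : cantor_minimal a ai) (mY : cantor_minimal b bi).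
Hypothesis loY : locconst oY.
Hypothesis conj : approx_conj a b oX oY.

Let hX : homeo_pair a ai. Proof. by case: mX. Qed.
Let hY : homeo_pair b bi. Proof. by case: mY. Qed.

(** Choosing the eigenfunction itself as [F] makes its pullback by [t] an exact eigenfunction of
    [a]. *)
Lemma approx_conj_PS : PS b `<=` PS a.
Proof.
move=> p /(PS_eigenfunction p hY)[p0 [theta [lt tb]]].
apply/(PS_eigenfunction p hX); split => //.
have [t [ti [h [[ct _ _ _] _ Ft _]]]] := conj lt.
exists (fun x => theta (t x)); split; first exact: locconst_comp.
by move=> x; rewrite -Ft.
Qed.

Lemma approx_conj_cob : cob_bool bi oY -> cob_bool ai oX.
Proof.
move=> /(cob_boolP _ hY)[k [lk ok]]; apply/(cob_boolP _ hX).
have [t [ti [h [[ct _ _ _] lh Ft ht]]]] := conj lk.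
exists (fun x => h x (+) k (t x)); split.
  by apply: locconst_fun2 => //; exact: locconst_comp.
move=> x; have := ht x; rewrite ok Ft.
by case: (h _); case: (h _); case: (k _); case: (k _); case: (oX x).
Qed.

Lemma PS_skew2_sub : PS b `<=` PS (skew2 b oY).
Proof.
move=> p /(PS_eigenfunction p hY)[p0 [theta [lt tb]]].
apply/(PS_eigenfunction p (skew2_homeo loY hY)); split => //.
exists (fun z => theta z.1); split.
  by apply: (@locconst_prod_bool _ _ (fun y _ => theta y)).
by move=> z; rewrite /skew2 /= tb.
Qed.

(** A modulus [p] of the extension that is not one of [b] provides an eigenfunction that
    distinguishes the sheets; its increments, divided by the sheet shift, give the root of
    [[1_Y]]. *)
Lemma approx_conj_half : ~ cob_bool bi oY -> PS (skew2 b oY) <> PS b ->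
  exists (n : nat) (f : X -> int) (g : Y -> int),
  [/\ (0 < n)%N, locconst f, locconst g,
    cob_int ai (fun x => 2 ^+ n.-1 * f x - 1) /\
    cob_bool ai (fun x => odd `|f x|%N (+) oX x) &
    cob_int bi (fun y => 2 ^+ n.-1 * g y - 1) /\
    cob_bool bi (fun y => odd `|g y|%N (+) oY y)].
Proof.
move=> nco nPS.
have [p [pS pb]] : exists p, PS (skew2 b oY) p /\ ~ PS b p.
  apply: contrapT => np; apply: nPS; apply/seteqP; split => [p ps|]; last exact: PS_skew2_sub.
  by apply: contrapT => npb; apply: np; exists p.
have [p0 [theta [lt tb]]] := (PS_eigenfunction p (skew2_homeo loY hY)).1 pS.
have ltk k : locconst (fun y => theta (y, k)).
  apply: (@locconst_comp _ _ _ (fun y => (y, k)) theta) => //.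
  apply: (@continuous_pair _ _ _ id (fun=> k)); first by move=> ?; exact: cvg_id.
  by move=> ?; exact: cvg_cst.
have tbk y k : (theta (b y, k (+) oY y) = theta (y, k) + 1 %[mod p])%N by exact: (tb (y, k)).
have [c [cp tc c2]] := skew2_eigen_flip mY nco (theta := fun y k => theta (y, k)) p0 ltk tbk.
have [c0|c0] := posnP c.
  exfalso; apply: pb; apply/(PS_eigenfunction p hY); split => //.
  exists (fun y => theta (y, false)); split; first exact: ltk.
  move=> y; rewrite -tbk /=; case: (oY y) => //.
  by rewrite tc c0 addn0.
(* [2c] is a multiple of [p] with [0 < c < p], so the multiple is exactly one. *)
have pE : p = (c + c)%N.
  move: c2; rewrite mod0n => /eqP /dvdnP[k kE].
  case: k kE => [|[|k]]; rewrite ?mul1n //; first lia.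
  move=> e; exfalso; nia.
pose s y : int := (theta (y, false))%:Z.
(* Along [b] the sheet [false] of [theta] increases by [1], up to one shift by [c] when [oY y] holds
   and multiples of [2c]; hence divisibility by [c] and the parity of the quotient. *)
have /choice [g0 g0P] : forall y, exists g0 : int,
    c%:Z * g0 = s y + 1 - s (b y) /\ odd `|g0|%N = oY y.
  move=> y; have := tbk y false; rewrite /=.
  have -> : (theta (b y, oY y) = theta (b y, false) + oY y * c %[mod p])%N.
    by case: (oY y); rewrite ?mul1n ?addn0 // tc.
  move/modn_eq_int => [k]; rewrite /s !PoszD pE PoszM => e.
  exists ((oY y)%:Z - 2 * k); split; last first.
    by case: (oY y); lia.
  rewrite mulrBr; move: e; rewrite PoszD.
  set A := Posz (theta _); set B := Posz (theta _) => e; lra.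
(* Here [c = m * 2 ^ k] with [m] odd. Multiplying [g0] by [m] leaves its parity unchanged and
   replaces the factor [c] by [2 ^ k], so the exponent [n] is [k.+1]. *)
have [m codd cm] := pfactor_coprime (isT : prime 2) c0.
set k := logn 2 c in cm.
have modd : odd m by rewrite coprime2n in codd.
have lg0 : locconst g0.
  have ls : locconst (fun y => (theta (y, false), theta (b y, false))).
    apply: locconst_pair; first exact: ltk.
    apply: (@locconst_comp _ _ _ b (fun y => theta (y, false))) => //.
    by case: hY.
  move=> y; apply: filterS (ls y) => z [e1 e2].
  have [g1 _] := g0P y; have [g2 _] := g0P z.
  have c0' : c%:Z != 0 by lia.
  by apply: (mulfI c0'); rewrite g1 g2 /s e1 e2.
pose g y := m%:Z * g0 y.
have lg : locconst g by exact: (locconst_fun (fun v => m%:Z * v)).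
have gE y : 2 ^+ k * g y - 1 = s y - s (b y).
  have [h _] := g0P y; rewrite /g mulrA.
  have -> : 2 ^+ k * m%:Z = c%:Z :> int by rewrite cm PoszM mulrC -[Posz (2 ^ k)]natz natrX.
  rewrite h; ring.
have godd y : odd `|g y|%N = oY y.
  by have [_ h] := g0P y; rewrite /g abszM oddM /= modd.
have ls : locconst s by apply: (locconst_fun (fun n : nat => n%:Z)); exact: ltk.
(* Respecting [s] makes [s \o t] an exact transfer function on [X], so [g \o t] is the root
   there. *)
have [t [ti [h [[ct cti _ _] lh Ft ht]]]] := conj ls.
exists k.+1, (fun x => g (t x)), g; split => //=.
- exact: locconst_comp.
- split; last first.
    apply/(cob_boolP _ hX); exists h; split => // x; rewrite godd.
    have := ht x; by case: (h _); case: (h _); case: (oX _); case: (oY _).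
  apply/(cob_intP _ hX); exists (fun x => - s (t x)); split.
    by apply: (@locconst_comp _ _ _ t (fun y => - s y)) => //; exact: (locconst_fun -%R).
  by move=> x; rewrite gE Ft opprK addrC.
- split; last first.
    exists (fun=> false); split; first exact: locconst_cst.
    by move=> y; rewrite godd addbb.
  apply/(cob_intP _ hY); exists (fun y => - s y); split; first exact: (locconst_fun -%R).
  by move=> y; rewrite gE opprK addrC.
Qed.

End Necessary.

(** * Coding towers by labelled walks *)

Section Itineraries.
Variables (X : topologicalType) (a ai : X -> X).
Hypothesis mX : cantor_minimal a ai.
Variables (n : nat) (E : rel 'I_n) (lab : 'I_n -> bool) (oX : X -> bool).
Hypothesis loX : locconst oX.
Variable v0 : 'I_n.
Variable W : set X.
Hypotheses (cW : clopen W) (W0 : W !=set0).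

Lemma itinerary_exists :
  (forall x l, W x -> returns a W x l -> exists p : nat -> 'I_n,
    [/\ p 0%N = v0, p l = v0, forall i, (i < l)%N -> E (p i) (p i.+1),
        forall v w, E v w -> exists2 i, (i < l)%N & p i = v /\ p i.+1 = w &
        \big[addb/false]_(i < l) lab (p i) =
        \big[addb/false]_(i < l) oX (iter i a x)]) ->
  exists (q : X -> 'I_n) (h : X -> bool),
    [/\ locconst q, locconst h, forall x, E (q x) (q (a x)),
        forall v w, E v w -> exists x, q x = v /\ q (a x) = w &
        forall x, h (a x) (+) oX x = lab (q x) (+) h x].
Proof.
move=> hp.
(* The second coordinate of a string accumulates the discrepancy between [lab] and [oX]. Equal sums
   over a tower bring it back to [false], so it glues to the transfer function [h]. *)
pose Good (x : X) (l : nat) (P : nat -> 'I_n * bool) :=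
  [/\ P 0%N = (v0, false) /\ P l = (v0, false),
      forall i, (i < l)%N -> E (P i).1 (P i.+1).1,
      forall v w, E v w -> exists2 i, (i < l)%N & (P i).1 = v /\ (P i.+1).1 = w &
      forall i, (i < l)%N -> (P i.+1).2 = (P i).2 (+) lab (P i).1 (+) oX (iter i a x)].
have ca : continuous a by case: mX => _ [].
have [||q [lq qP]] := @tower_select X a ai mX W cW W0 _ (v0, false) Good.
- by move=> x l p [].
- move=> x l Wx rl; have [p [p0 pl pE pS pe]] := hp x l Wx rl.
  exists (fun i => (p i, \big[addb/false]_(j < i) (lab (p j) (+) oX (iter j a x)))).
  have := @locconst_all X bool l (fun i x => oX (iter i a x)) _ x.
  move=> h; have {}h := h (fun i => locconst_comp (@continuous_iter _ _ ca i) loX).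
  apply: filterS h => y h; split => //=.
    by rewrite big_ord0 p0 pl big_split /= pe addbb.
  by move=> i il; rewrite big_ord_recr /= h // addbA.
have step z : exists x l P i, [/\ Good x l P, (i < l)%N, z = iter i a x,
    q z = P i & q (a z) = P i.+1].
  have [x [l [i [Wx rl il zE]]]] := tower_cover mX cW W0 z.
  have [P [GP qE]] := qP x l Wx rl; exists x, l, P, i; split => //.
    by rewrite zE qE // ltnW.
  by rewrite zE -iterS qE.
exists (fun x => (q x).1), (fun x => (q x).2); split.
- exact: (locconst_fun fst).
- exact: (locconst_fun snd).
- by move=> z; have [x [l [P [i [[_ PE _ _] il _ -> ->]]]]] := step z; exact: PE.
- move=> v w vw; have [x Wx] := W0; have [l rl] := returns_exists mX cW W0 x.
  have [P [[_ _ PS _] qE]] := qP x l Wx rl; have [i il [iv iw]] := PS v w vw.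
  by exists (iter i a x); rewrite -iterS !qE // ltnW.
- move=> z; have [x [l [P [i [[_ _ _ Ph] il -> -> ->]]]]] := step z.
  rewrite Ph //; by case: (P i).2; case: (lab _); case: (oX _).
Qed.

End Itineraries.

Definition cell_rel (Y : Type) (b : Y -> Y) n (Q : Y -> 'I_n) : rel 'I_n :=
  fun v w => `[< exists y, Q y = v /\ Q (b y) = w >].

Lemma cell_relP (Y : Type) (b : Y -> Y) n (Q : Y -> 'I_n) y :
  cell_rel b Q (Q y) (Q (b y)).
Proof. by apply/asboolP; exists y. Qed.

(** [t] matches the finer cells indexed by edges, which both systems use in full; the end vertex of
    the edge at [x] then names the cell of both [b (t x)] and [t (a x)]. *)
Lemma itinerary_homeo (R : realType) (X Y : pseudoMetricType R) (a : X -> X)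
    (b : Y -> Y) n (Q : Y -> 'I_n) (q : X -> 'I_n) :
  cantor_set X -> cantor_set Y -> continuous a -> continuous b ->
  locconst q -> locconst Q ->
  (forall x, cell_rel b Q (q x) (q (a x))) ->
  (forall v w, cell_rel b Q v w -> exists x, q x = v /\ q (a x) = w) ->
  exists (t : X -> Y) (ti : Y -> X), [/\ homeo_pair t ti,
    forall x, Q (t x) = q x & forall x, Q (b (t x)) = Q (t (a x))].
Proof.
move=> cX cY ca cb lq lQ qE Eq.
have [||||t [ti [tti tE]]] := @cantor_partition_homeo R X Y _
  (fun x => (q x, q (a x))) (fun y => (Q y, Q (b y))) cX cY.
- by apply: locconst_pair => //; exact: locconst_comp.
- by apply: locconst_pair => //; exact: locconst_comp.
- by move=> x; have /asboolP[y [<- <-]] := qE x; exists y.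
- by move=> y; have [x [<- <-]] := Eq _ _ (cell_relP b Q y); exists x.
exists t, ti; split => // x; have [e1 e2] := tE x => //.
by have [e3 _] := tE (a x); rewrite e2 e3.
Qed.

Section ReturnTimes.
Variables (X : topologicalType) (a ai : X -> X).
Hypothesis mX : cantor_minimal a ai.

(** The base lies in one level set of an eigenfunction, so returning to it takes a multiple of [D]
    steps. *)
Lemma PS_base (V : Type) (F : X -> V) (D K : nat) : PS a D -> locconst F ->
  exists W : set X, [/\ clopen W, W !=set0,
    forall x y, W x -> W y -> F x = F y &
    forall x l, W x -> returns a W x l -> (K <= l)%N /\ (D %| l)%N].
Proof.
have hX : homeo_pair a ai by case: mX.
move=> /(PS_eigenfunction D hX)[D0 [theta [lt tb]]] lF.
have [_ [x0 _]] : cantor_set X by case: mX.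
have [W [cW Wx0 WF WK]] := small_base mX K x0 (locconst_pair lt lF).
exists W; split => //; first by exists x0.
  by move=> x y /WF[_ ->] /WF[_ ->].
move=> x l Wx [l0 Wl _]; split.
  by rewrite leqNgt; apply/negP => lK; apply: (WK x l) => //; rewrite l0.
have := iter_congr tb l x; have [-> _] := WF _ Wl; have [-> _] := WF _ Wx.
by move/eqP; rewrite -{1}[theta x0]addn0 eqn_modDl mod0n eq_sym.
Qed.

End ReturnTimes.

Lemma odd_abszD (m n : int) : odd `|(m + n)%R|%N = odd `|m|%N (+) odd `|n|%N.
Proof. by lia. Qed.

Lemma odd_abs_parity (s1 s2 : bool) (g : int) : odd `|g|%N = s1 (+) s2 ->
  exists m : int, s1%:Z - s2%:Z - g = 2 * m.
Proof.
move=> h; exists ((s1%:Z - s2%:Z - g) %/ 2)%Z.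
by move: h; case: s1; case: s2 => /=; lia.
Qed.

(** * From condition (2) to approximate conjugacy *)

Section Sufficient.
Variables (R : realType) (X Y : pseudoMetricType R).
Variables (a ai : X -> X) (b bi : Y -> Y) (oX : X -> bool) (oY : Y -> bool).
Hypotheses (mX : cantor_minimal a ai) (mY : cantor_minimal b bi).
Hypotheses (loX : locconst oX) (loY : locconst oY).
Hypothesis PSab : PS b `<=` PS a.

Let hX : homeo_pair a ai. Proof. by case: mX. Qed.
Let hY : homeo_pair b bi. Proof. by case: mY. Qed.
Let ca : continuous a. Proof. by case: hX. Qed.
Let cb : continuous b. Proof. by case: hY. Qed.
Let cX : cantor_set X. Proof. by case: mX. Qed.
Let cY : cantor_set Y. Proof. by case: mY. Qed.
Let kY : compact [set: Y]. Proof. by case: cY => -[]. Qed.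

Lemma base_conj (V : Type) (F : Y -> V) : locconst F ->
  exists (t : X -> Y) (ti : Y -> X), homeo_pair t ti /\
    forall x, F (b (t x)) = F (t (a x)).
Proof.
move=> lF; have [n [Q [lQ sQ QF]]] := locconst_partition kY lF.
pose E := cell_rel b Q.
(* The points whose cell is reachable from [v] form a nonempty clopen forward invariant set, which
   is all of [Y] by minimality. *)
have Econ v w : connect E v w.
  have [y <-] := sQ w; have [y0 vE] := sQ v.
  have -> : connect E v (Q y) <-> [set y | connect E v (Q y)] y by [].
  rewrite (closed_forward_invariant mY (A := [set y | connect E v (Q y)])) //.
  - by case: (locconst_clopen (fun w => connect E v w) lQ).
  - by exists y0; rewrite /= vE.
  - by move=> z /= vz; apply: connect_trans vz (connect1 _); exact: cell_relP.
have Eout v : exists w, E v w.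
  by have [y <-] := sQ v; exists (Q (b y)); exact: cell_relP.
have [_ [y0 _]] := cY; pose v0 := Q y0.
have [D [K [f [D0 fE fw]]]] := strongly_connected_period Econ Eout v0.
(* The vertex function [f] read through [Q] is an eigenfunction of [b], so [D] lies in [PS b]; the
   inclusion then provides towers of [X] with heights divisible by [D]. *)
have PD : PS a D.
  apply: PSab; apply/(PS_eigenfunction D hY); split => //.
  exists (fun y => f (Q y)); split; first exact: (locconst_fun f).
  by move=> y; apply: fE; exact: cell_relP.
have [W [cW W0 _ Wr]] := PS_base mX K PD (@locconst_cst X _ tt).
have [|q [h [lq _ qE Eq _]]] := @itinerary_exists X a ai mX n E (fun=> false)
   (fun=> false) (@locconst_cst X _ false) v0 W cW W0.
  move=> x l Wx rl; have [Kl Dl] := Wr x l Wx rl.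
  have [|p [p0 pl pE pS]] := fw v0 v0 l Kl.
    by rewrite -modnDmr (eqP Dl) addn0.
  exists p; split => //.
  move=> v w vw; have [|i il [<- <-]] := pS (v, w); last by exists i.
  by rewrite mem_filter vw mem_enum.
have [t [ti [tti _ tb]]] := itinerary_homeo cX cY ca cb lq lQ qE Eq.
by exists t, ti; split => // x; apply: QF.
Qed.

Lemma approx_conj_trivial : cob_bool bi oY -> cob_bool ai oX ->
  approx_conj a b oX oY.
Proof.
move=> /(cob_boolP _ hY)[k [lk ok]] /(cob_boolP _ hX)[m [lm om]] V F lF.
(* Including [k] in the data makes [oY \o t] the coboundary of [k \o t], which combines with [m]
   into [h]. *)
have [t [ti [tti tF]]] := base_conj (locconst_pair lF lk).
exists t, ti, (fun x => m x (+) k (t x)); split => //.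
- by apply: locconst_fun2 => //; apply: locconst_comp => //; case: tti.
- by move=> x; have [] := tF x.
- move=> x; have [_ e] := tF x; rewrite ok om e.
  by case: (m _); case: (m _); case: (k _); case: (k _).
Qed.

Hypothesis noY : ~ cob_bool bi oY.

(** The common core of cases (b) and (c): the last clause reduces the conjugacy to a congruence
    between tower heights and orientation sums modulo the period [D]. The clause on [M] shows that
    [D] is a multiple of the modulus of every eigenfunction visible through [Q]. *)
Lemma skew_graph (V : Type) (F : Y -> V) : locconst F ->
  exists n (Q : Y -> 'I_n) (D K : nat) (f : 'I_n * bool -> nat),
  [/\ locconst Q /\ (forall y y', Q y = Q y' -> F y = F y'),
    (0 < D)%N,
    forall y k, (f (Q (b y), k (+) oY y) = f (Q y, k) + 1 %[mod D])%N,
    forall M (f' : Y -> bool -> nat), (forall y y' k, Q y = Q y' -> f' y k = f' y' k) ->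
      (forall y k, f' (b y) (k (+) oY y) = f' y k + 1 %[mod M])%N -> (M %| D)%N &
    forall W : set X, clopen W -> W !=set0 ->
      (forall x l, W x -> returns a W x l -> (K <= l)%N /\ forall y,
        (f (Q y, \big[addb/false]_(i < l) oX (iter i a x)) = f (Q y, false) + l
          %[mod D])%N) ->
      exists (t : X -> Y) (ti : Y -> X) (h : X -> bool),
        [/\ homeo_pair t ti, locconst h, forall x, F (b (t x)) = F (t (a x)) &
        forall x, h (a x) (+) oX x = oY (t x) (+) h x]].
Proof.
move=> lF; have [n [Q [lQ sQ QF]]] := locconst_partition kY (locconst_pair lF loY).
have /choice [r rP] := sQ.
pose lab v := oY (r v).
have labE y : lab (Q y) = oY y by have [] := QF _ _ (rP (Q y)).
pose E := cell_rel b Q.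
pose E2 (z z' : 'I_n * bool) := E z.1 z'.1 && (z'.2 == z.2 (+) lab z.1).
have E2b y k : E2 (Q y, k) (Q (b y), k (+) oY y).
  by rewrite /E2 /= labE eqxx andbT; exact: cell_relP.
have E2P z z' : E2 z z' -> exists y, z = (Q y, z.2) /\ z' = (Q (b y), z.2 (+) oY y).
  case: z z' => [v k] [w j] /andP[/asboolP /= [y [<- <-]] /eqP ->].
  by exists y; rewrite labE.
(* The extended graph is strongly connected because [oY] is not a coboundary: reachable points form
   a forward invariant set of the extension. *)
have Econ z z' : connect E2 z z'.
  case: z' => w j; have [y <-] := sQ w.
  apply: (skew2_forward_invariant mY noY (A := fun y j => connect E2 z (Q y, j))).
  - by move=> k; apply: (locconst_fun (fun v => connect E2 z (v, k))).
  - by case: z => v k; have [y0 <-] := sQ v; exists y0, k.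
  - by move=> y' k zy; apply: connect_trans zy (connect1 _).
have Eout z : exists z', E2 z z'.
  by case: z => v k; have [y0 <-] := sQ v; eexists; exact: E2b.
have [_ [y0 _]] := cY; pose v0 := Q y0.
have [D [K [f [D0 fE fw]]]] := strongly_connected_period Econ Eout (v0, false).
exists n, Q, D, K, f; split => //.
- by split => // y y' /QF[].
- by move=> y k; apply: fE.
- move=> M f' f'Q f'b.
  have cong := @walk_congr _ E2 M (fun z => f' (r z.1) z.2) _.
  have {}cong l v w S : walk E2 l v w S -> (f' (r w.1) w.2 = f' (r v.1) v.2 + l %[mod M])%N.
    apply: cong => {l v w S} z z' /E2P[y [-> ->]] /=.
    by rewrite (f'Q (r (Q y)) y) ?rP // (f'Q (r (Q (b y))) (b y)) ?rP // f'b.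
  (* Closed walks exist only for long lengths; two consecutive large multiples of [D] suffice to get
     [M] dividing [D]. *)
  have MD i : (K <= i * D)%N -> (M %| i * D)%N.
    move=> Ki; have := fw (v0, false) (v0, false) (i * D)%N Ki.
    rewrite -modnDmr modnMl addn0 => /(_ erefl) /cong /eqP.
    by rewrite -{1}[f' _ _]addn0 eqn_modDl mod0n eq_sym.
  have h1 := MD K (leq_pmulr _ D0).
  have h2 : (M %| K.+1 * D)%N by apply: MD; rewrite mulSn; have := leq_pmulr K D0; lia.
  by move: h2; rewrite mulSn dvdn_addl.
- move=> W cW W0 Wr.
  have [|q [h [lq lh qE Eq hq]]] := @itinerary_exists X a ai mX n E lab oX loX v0 W cW W0.
    move=> x l Wx rl; have [Kl fl] := Wr x l Wx rl.
    (* The walk ends on the sheet given by the orientation sum of the tower, which is thus the sum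
       of the labels along it. *)
    have [P [P0 Pl PE PS]] := fw (v0, false) (v0, _) l Kl (fl y0).
    exists (fun i => (P i).1); split; rewrite ?P0 ?Pl //.
    + by move=> i /PE /andP[].
    + move=> v w /asboolP[y [<- <-]].
      have [|i il e] := PS ((Q y, false), (Q (b y), oY y)).
        by rewrite mem_filter mem_enum andbT; exact: (E2b y false).
      by exists i => //; case: e => -> ->.
    + have sumP i : (i <= l)%N -> (P i).2 = \big[addb/false]_(j < i) lab (P j).1.
        elim: i => [|i IH] il; first by rewrite big_ord0 P0.
        by rewrite big_ord_recr /= -IH ?(ltnW il) //; case/andP: (PE i il) => _ /eqP.
      by rewrite -sumP // Pl.
  have [t [ti [tti tq tb]]] := itinerary_homeo cX cY ca cb lq lQ qE Eq.
  exists t, ti, h; split => // [x|x]; first by have [] := QF _ _ (tb x).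
  by rewrite hq -tq labE.
Qed.

(** Here [b] itself has an eigenfunction modulo [D], and [f] differs from it by a constant. So [f]
    ignores the sheet, and every long multiple of [D] is realised with either label. *)
Lemma approx_conj_aperiodic : PS (skew2 b oY) = PS b -> approx_conj a b oX oY.
Proof.
move=> PSE V F lF.
have [n [Q [D [K [f [[lQ _] D0 fE _ fin]]]]]] := skew_graph lF.
have lf k : locconst (fun y => f (Q y, k)) by exact: (locconst_fun (fun v => f (v, k))).
have PbD : PS b D.
  rewrite -PSE; apply/(PS_eigenfunction D (skew2_homeo loY hY)); split => //.
  exists (fun z => f (Q z.1, z.2)); split; last by move=> z; exact: fE.
  exact: (@locconst_prod_bool _ _ (fun y k => f (Q y, k))).
have [_ [theta [lt tb]]] := (PS_eigenfunction D hY).1 PbD.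
have [W [cW W0 _ Wr]] := PS_base mX K (PSab PbD) (@locconst_cst X _ tt).
apply: (fin W cW W0) => x l Wx rl; have [Kl Dl] := Wr x l Wx rl; split => // y.
rewrite -[RHS]modnDmr (eqP Dl) addn0.
have := skew2_eigen_shift mY noY D0 lf (fun=> lt) fE (fun y _ => tb y) y.
by move=> /(_ (\big[addb/false]_(i < l) oX (iter i a x)) y false) /eqP; rewrite eqn_modDr => /eqP.
Qed.

(** The root [g] yields an eigenfunction of the extension modulo [2N] that separates the sheets by
    [N]. It fixes the relation between length and label in the graph, and [f] imposes the same
    relation on the towers of [X]. *)
Lemma approx_conj_root (N : nat) (f : X -> int) (g : Y -> int) : (0 < N)%N ->
  locconst f -> locconst g ->
  cob_int ai (fun x => N%:Z * f x - 1) -> cob_bool ai (fun x => odd `|f x|%N (+) oX x) ->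
  cob_int bi (fun y => N%:Z * g y - 1) -> cob_bool bi (fun y => odd `|g y|%N (+) oY y) ->
  approx_conj a b oX oY.
Proof.
move=> N0 lf lg /(cob_intP _ hX)[uX [luX uXE]] /(cob_boolP _ hX)[kX [lkX kXE]].
move=> /(cob_intP _ hY)[u [lu uE]] /(cob_boolP _ hY)[k [lk kE]] V F lF.
pose M := (N + N)%N.
(* Along [b], [- u] changes by [1 - N g]; the sheet term, corrected by [k], changes by [N] times an
   integer of the parity of [g]. In total this is [1] modulo [2N]. *)
pose w y (j : bool) : int := - u y + N%:Z * (j (+) k y)%:Z.
pose theta y j := `|(w y j %% M%:Z)%Z|%N.
have thetaE y j : exists m : int, (theta y j)%:Z = w y j + m * M%:Z.
  exists (- (w y j %/ M%:Z)%Z); rewrite /theta gez0_abs; last first.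
    by rewrite modz_ge0 //; lia.
  by rewrite {2}(divz_eq (w y j) M%:Z); ring.
have thetab y j : (theta (b y) (j (+) oY y) = theta y j + 1 %[mod M])%N.
  have [m1 e1] := thetaE (b y) (j (+) oY y).
  have [m2 e2] := thetaE y j.
  have [m3 e3] : exists m : int,
      (j (+) oY y (+) k (b y))%:Z - (j (+) k y)%:Z - g y = 2 * m.
    apply: odd_abs_parity; have := kE y.
    by case: (odd _); case: (oY y); case: (k y); case: (k (b y)); case: (j).
  apply: (@int_eq_modn _ _ _ (m3 + m1 - m2)); rewrite PoszD e1 e2 /w.
  have -> : u (b y) = u y + (N%:Z * g y - 1) by rewrite uE addrC subrK.
  have -> : (j (+) oY y (+) k (b y))%:Z = 2 * m3 + (j (+) k y)%:Z + g y.
    by rewrite -e3; ring.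
  by rewrite /M PoszD; ring.
have thetaS y : (theta y true = theta y false + N %[mod M])%N.
  have [m1 e1] := thetaE y true; have [m2 e2] := thetaE y false.
  apply: (@int_eq_modn _ _ _ (- (k y)%:Z + m1 - m2)); rewrite PoszD e1 e2 /w /M PoszD.
  by case: (k y) => /=; ring.
have ltheta j : locconst (theta^~ j).
  exact: (locconst_fun2 (fun (p : int) (q : bool) =>
    `|((- p + N%:Z * (j (+) q)%:Z) %% M%:Z)%Z|%N) lu lk).
have [n [Q [D [K [F2 [[lQ QF] D0 FE FM fin]]]]]] :=
  skew_graph (locconst_pair lF (locconst_pair lu lk)).
(* [Q] refines [u] and [k], so [theta] is visible through [Q]. *)
have MD : (M %| D)%N.
  apply: (FM M theta) => // y y' j /QF[_ eu ek]; by rewrite /theta /w eu ek.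
have lF2 j : locconst (fun y => F2 (Q y, j)) by exact: (locconst_fun (fun v => F2 (v, j))).
have M0 : (0 < M)%N by rewrite /M addn_gt0 N0.
have FEM y j : (F2 (Q (b y), j (+) oY y) = F2 (Q y, j) + 1 %[mod M])%N.
  by rewrite -(modn_dvdm _ MD) FE modn_dvdm.
have [c [cD cE c2]] := skew2_eigen_flip mY noY (theta := fun y j => F2 (Q y, j)) D0 lF2 FE.
have [_ [y0 _]] := cY.
(* Modulo [2N] the functions [F2] and [theta] differ by a constant, so they have the same sheet
   shift; hence [c] is an odd multiple of [N]. *)
have cN : (c = N %[mod M])%N.
  have e : (F2 (Q y0, true) = F2 (Q y0, false) + c %[mod M])%N.
    by rewrite -(modn_dvdm _ MD) cE modn_dvdm.
  have shift := skew2_eigen_shift mY noY M0 lF2 ltheta FEM thetab y0 true y0 false.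
  apply/eqP; rewrite -(eqn_modDl (F2 (Q y0, false) + theta y0 false)).
  by rewrite addnAC -modnDml -e modnDml shift -addnA -modnDmr thetaS modnDmr.
have [i ci] : exists i, c = (N * i.*2.+1)%N.
  exists (c %/ M)%N; rewrite {1}(divn_eq c M) cN modn_small /M; last by lia.
  by rewrite -mul2n; lia.
have c0 : (0 < c)%N by rewrite ci muln_gt0 N0.
have DE : D = (c + c)%N.
  move: c2; rewrite mod0n => /eqP /dvdnP[m mE].
  case: m mE => [|[|m]]; rewrite ?mul1n //; first by lia.
  by move=> e; exfalso; nia.
have cdD : (c %| D)%N by rewrite DE dvdn_addr.
(* Modulo [c] the two sheets of [F2] agree, so [F2] descends to an eigenfunction of [b]. *)
have PSc : PS a c.
  apply: PSab; apply/(PS_eigenfunction c hY); split => //.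
  exists (fun y => F2 (Q y, false)); split; first exact: lF2.
  move=> y; have := FE y false; move=> /(congr1 (fun m => m %% c)%N).
  rewrite !modn_dvdm //= => <-; case: (oY y) => //.
  by rewrite -(modn_dvdm (F2 (_, true)) cdD) cE modn_dvdm // modnDr.
have [W [cW W0 WF Wr]] := PS_base mX K PSc (locconst_pair luX lkX).
have [|t [ti [h [tti lh tF th]]]] := fin W cW W0; last first.
  by exists t, ti, h; split => // x; have [] := tF x.
move=> x l Wx rl; have [Kl /dvdnP[j lE]] := Wr x l Wx rl.
split => // y.
(* Birkhoff sums of [f]: up to boundary terms, which cancel on a return to [W], [N] times [S l] is
   [l] and the parity of [S l] is the orientation sum. *)
pose S m : int := \sum_(i < m) f (iter i a x).
have SN m : N%:Z * S m - m%:Z = uX (iter m a x) - uX x.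
  elim: m => [|m IH]; first by rewrite /S big_ord0 mulr0 !subrr.
  rewrite /S big_ord_recr /= -/(S m) mulrDr.
  have -> : uX (a (iter m a x)) = uX (iter m a x) + (N%:Z * f (iter m a x) - 1).
    by rewrite uXE addrC subrK.
  rewrite -addn1 PoszD; move: IH.
  set A := N%:Z * S m; set B := N%:Z * f _ => IH.
  have -> : A = uX (iter m a x) - uX x + m%:Z by rewrite -IH subrK.
  ring.
have So m : \big[addb/false]_(i < m) oX (iter i a x) =
    odd `|S m|%N (+) (kX x (+) kX (iter m a x)).
  elim: m => [|m IH]; first by rewrite /S !big_ord0 /= addbb.
  rewrite /S !big_ord_recr /= -/(S m) IH.
  have := kXE (iter m a x).
  rewrite odd_abszD.
  by case: (odd `|S m|%N); case: (odd _); case: (oX _); case: (kX x); case: (kX _); case: (kX _).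
have Wl : W (iter l a x) by case: rl.
have [eu ek] := WF _ _ Wl Wx.
have SE : S l = (i.*2.+1 * j)%N%:Z.
  have N0' : N%:Z != 0 by lia.
  apply: (mulfI N0'); rewrite -PoszM; have := SN l; rewrite eu subrr => /eqP.
  by rewrite subr_eq0 => /eqP ->; congr Posz; rewrite lE ci; lia.
rewrite So ek addbb addbF SE absz_nat oddM /= odd_double /=.
(* The orientation sum has been reduced to the parity of [j], and since [D = 2c], modulo [D] the
   length [l = jc] is exactly the corresponding sheet shift. *)
have -> : l = (odd j * c + j./2 * D)%N.
  by rewrite lE DE -{1}(odd_double_half j) -muln2; lia.
rewrite addnA -[RHS]modnDmr modnMl addn0.
by case: (odd j); rewrite ?mul1n ?addn0 //= cE.
Qed.

End Sufficient.

(** * The circle and its isometries *)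

Section RealContinuity.
Variables (R : realType) (S : topologicalType).
Implicit Types f g : S -> R.

Lemma continuous_realM f g :
  continuous f -> continuous g -> continuous (fun p => f p * g p).
Proof. by move=> cf cg p; apply: continuousM; [exact: cf | exact: cg]. Qed.

Lemma continuous_realD f g :
  continuous f -> continuous g -> continuous (fun p => f p + g p).
Proof. by move=> cf cg p; apply: continuousD; [exact: cf | exact: cg]. Qed.

Lemma continuous_realB f g :
  continuous f -> continuous g -> continuous (fun p => f p - g p).
Proof. by move=> cf cg p; apply: continuousB; [exact: cf | exact: cg]. Qed.

Lemma continuous_realN f : continuous f -> continuous (fun p => - f p).
Proof. by move=> cf p; apply: continuousN; exact: cf. Qed.

Lemma continuous_realC (c : R) : continuous (fun _ : S => c).
Proof. by move=> p; exact: cvg_cst. Qed.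

End RealContinuity.

Section Circle.
Variable R : realType.
Notation T := (Tcirc R).

Definition tx (p : T) : R := (set_val p).1.
Definition ty (p : T) : R := (set_val p).2.

Lemma circleE (p : T) : tx p ^+ 2 + ty p ^+ 2 = 1.
Proof. exact: (set_valP p). Qed.

Lemma circle_eq (p q : T) : tx p = tx q -> ty p = ty q -> p = q.
Proof.
rewrite /tx /ty => e1 e2; apply: val_inj.
by apply/eqP; rewrite -pair_eqE /pair_eq /=; apply/andP; split; apply/eqP.
Qed.

Definition circle_pt (x y : R) (h : x ^+ 2 + y ^+ 2 = 1) : T :=
  SigSub (mem_set (h : circle_set (x, y))).

Lemma iso_subproof (t : R) (e : bool) (p : T) (c := cos (2 * pi * t))
    (s := sin (2 * pi * t)) (y := if e then - ty p else ty p) :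
  (c * tx p - s * y) ^+ 2 + (s * tx p + c * y) ^+ 2 = 1.
Proof.
have h1 := cos2Dsin2 (2 * pi * t); have h2 := circleE p.
have -> : (c * tx p - s * y) ^+ 2 + (s * tx p + c * y) ^+ 2 =
  (c ^+ 2 + s ^+ 2) * (tx p ^+ 2 + y ^+ 2) by ring.
by rewrite h1 mul1r -h2 /y; case: (e); rewrite ?sqrrN.
Qed.

(* [isoT t e] is R_t when [e] is [false] and R_t \o lambda when [e] is [true]. *)
Definition isoT (t : R) (e : bool) (p : T) : T := circle_pt (iso_subproof t e p).

Lemma tx_isoT t e p : tx (isoT t e p) =
  cos (2 * pi * t) * tx p - sin (2 * pi * t) * (if e then - ty p else ty p).
Proof. by []. Qed.

Lemma ty_isoT t e p : ty (isoT t e p) =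
  sin (2 * pi * t) * tx p + cos (2 * pi * t) * (if e then - ty p else ty p).
Proof. by []. Qed.

Lemma isomTP (f : T -> T) : isomT f -> exists t e, f = isoT t e.
Proof.
move=> [t [h|h]]; [exists t, false|exists t, true]; apply/funext => p.
  by apply: val_inj; rewrite [val _]h.
by apply: circle_eq; rewrite ?tx_isoT ?ty_isoT /tx /ty h /=; ring.
Qed.

Lemma isoT_comp t e t' e' p : isoT t e (isoT t' e' p) =
  isoT (t + (if e then - t' else t')) (e (+) e') p.
Proof.
apply: circle_eq; rewrite ?(tx_isoT, ty_isoT).
all: have -> : 2 * pi * (t + (if e then - t' else t')) =
  2 * pi * t + (if e then - (2 * pi * t') else 2 * pi * t') by case: (e); ring.
all: by rewrite cosD sinD; case: e; case: e' => /=; rewrite ?cosN ?sinN; ring.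
Qed.

Lemma isoT0 p : isoT 0 false p = p.
Proof.
by apply: circle_eq; rewrite ?(tx_isoT, ty_isoT) mulr0 cos0 sin0; ring.
Qed.

Lemma isoT1 p : isoT 1 false p = p.
Proof.
apply: circle_eq; rewrite ?(tx_isoT, ty_isoT).
all: have -> : 2 * pi * 1 = pi *+ 2 :> R by rewrite mulr2n; ring.
all: by rewrite cos2pi sin2pi; ring.
Qed.

Lemma isoTD1 t e p : isoT (t + 1) e p = isoT t e p.
Proof. by rewrite addrC -[isoT t e p]isoT1 isoT_comp. Qed.

Lemma isoTDz t e p (z : int) : isoT (t + z%:~R) e p = isoT t e p.
Proof.
have nat_case n s : isoT (s + n%:R) e p = isoT s e p.
  by elim: n => [|n IH]; rewrite ?addr0 // -addn1 natrD addrA isoTD1.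
case: z => n; first exact: nat_case.
by rewrite NegzE mulrNz -(nat_case n.+1 (t - _)) subrK.
Qed.

Definition isoTi (t : R) (e : bool) : T -> T := isoT (if e then t else - t) e.

Lemma isoTK t e : cancel (isoT t e) (isoTi t e).
Proof.
move=> p; rewrite /isoTi isoT_comp addbb.
by case: e; rewrite ?subrr ?addNr isoT0.
Qed.

Lemma isoTiK t e : cancel (isoTi t e) (isoT t e).
Proof.
by move=> p; rewrite /isoTi isoT_comp addbb; case: e; rewrite subrr isoT0.
Qed.

Lemma continuous_circle (S : topologicalType) (f : S -> T) :
  continuous (fun s => tx (f s)) -> continuous (fun s => ty (f s)) -> continuous f.
Proof.
move=> cx cy; apply: continuous_comp_initial.
have -> : set_val \o f = (fun s => (tx (f s), ty (f s))).
  by apply/funext => s /=; rewrite /tx /ty -surjective_pairing.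
exact: continuous_pair.
Qed.

Lemma continuous_set_val : continuous (set_val : T -> (R * R)%type).
Proof. exact: initial_continuous. Qed.

Lemma continuous_tx : continuous tx.
Proof.
move=> p; apply: (@continuous_comp _ _ _ set_val fst); first exact: continuous_set_val.
exact: cvg_fst.
Qed.

Lemma continuous_ty : continuous ty.
Proof.
move=> p; apply: (@continuous_comp _ _ _ set_val snd); first exact: continuous_set_val.
exact: cvg_snd.
Qed.

Lemma continuous_isoT t e : continuous (isoT t e).
Proof.
pose y (p : T) : R := if e then - ty p else ty p.
have cy : continuous y.
  rewrite /y; case: (e) => /=; last exact: continuous_ty.
  exact: continuous_realN continuous_ty.
have cM (c : R) (f : T -> R) : continuous f -> continuous (fun p => c * f p).
  by move=> cf; apply: continuous_realM => //; exact: continuous_realC.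
apply: continuous_circle.
  exact: (continuous_realB (cM _ _ continuous_tx) (cM _ _ cy)).
exact: (continuous_realD (cM _ _ continuous_tx) (cM _ _ cy)).
Qed.

Definition ept (s : R) : T := circle_pt (cos2Dsin2 (2 * pi * s)).

Lemma ept_isoT s : ept s = isoT s false (ept 0).
Proof.
by apply: circle_eq; rewrite ?(tx_isoT, ty_isoT) /ept /tx /ty /= mulr0 cos0 sin0; ring.
Qed.

Lemma eptDz s (z : int) : ept (s + z%:~R) = ept s.
Proof. by rewrite ept_isoT isoTDz -ept_isoT. Qed.

Lemma continuous_ept : continuous ept.
Proof.
have c2 : continuous (fun s : R => 2 * pi * s).
  apply: continuous_realM; first exact: continuous_realC.
  by move=> s; exact: cvg_id.
apply: continuous_circle => s.
  by apply: (@continuous_comp _ _ _ (fun s : R => 2 * pi * s) cos); [exact: c2 | exact: continuous_cos].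
by apply: (@continuous_comp _ _ _ (fun s : R => 2 * pi * s) sin); [exact: c2 | exact: continuous_sin].
Qed.

(** Equality would give cosine [1] at twice the angle [pi (b - a)], which lies strictly between [0]
    and [pi], where the sine is positive. *)
Lemma ept_neq a b : a < b -> b < a + 1 -> ept a <> ept b.
Proof.
move=> ab ba e.
have e1 : tx (ept a) = tx (ept b) by rewrite e.
have e2 : ty (ept a) = ty (ept b) by rewrite e.
have e3 : cos (2 * pi * b - 2 * pi * a) = 1.
  rewrite cosB; move: e1 e2; rewrite /tx /ty /= => -> ->.
  by rewrite -!expr2 cos2Dsin2.
have : 0 < sin (pi * (b - a)).
  by apply: sin_gt0_pi; have := pi_gt0 R => pi0; apply/andP; split; nra.
have : 2 * pi * b - 2 * pi * a = (pi * (b - a)) *+ 2 by rewrite mulr2n; ring.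
move=> E; move: e3; rewrite E cos_mulr2n => e3.
have := cos2Dsin2 (pi * (b - a)); set C := cos _ in e3 *; set S := sin _.
move=> h1 h2; have : C ^+ 2 *+ 2 = 2 * C ^+ 2 by rewrite mulr2n; ring.
by nra.
Qed.

Lemma ept_surj (p : T) : exists s, ept s = p.
Proof.
have h := circleE p.
have x1 : -1 <= tx p <= 1 by apply/andP; split; nra.
have pi0 := pi_gt0 R.
pose s := acos (tx p) / (2 * pi).
have sE : 2 * pi * s = acos (tx p) by rewrite /s mulrC divfK //; apply/eqP; nra.
have c1 : cos (2 * pi * s) = tx p by rewrite sE acosK // in_itv /=.
have s0 : 0 <= sin (2 * pi * s).
  by rewrite sE; apply: sin_ge0_pi; rewrite acos_ge0 // acos_lepi.
have : tx p ^+ 2 + sin (2 * pi * s) ^+ 2 = tx p ^+ 2 + ty p ^+ 2.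
  by rewrite h -c1 cos2Dsin2.
move=> /addrI/eqP; rewrite eqf_sqr.
move=> /orP[/eqP e|/eqP e].
  by exists s; apply: circle_eq; [exact: c1 | exact: e].
exists (- s); apply: circle_eq; rewrite /ept /tx /ty /= mulrN ?cosN ?sinN //.
by rewrite e opprK.
Qed.

Lemma ept_surj_from (a : R) (p : T) : exists s, [/\ a <= s, s < a + 1 & ept s = p].
Proof.
have [s0 <-] := ept_surj p.
exists (s0 + (- Num.floor (s0 - a))%:~R); rewrite eptDz; split => //.
  by have := floor_le (s0 - a); rewrite mulrNz; lra.
by have := floorD1_gt (s0 - a); rewrite mulrNz intrD; lra.
Qed.

End Circle.

(** * Orientation of injective circle maps *)

Section Orientation.
Variable R : realType.
Notation T := (Tcirc R).

(** Twice the signed area of the triangle [p q r]. *)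
Definition det3 (p q r : T) : R :=
  (tx q - tx p) * (ty r - ty p) - (ty q - ty p) * (tx r - tx p).

Lemma det3_swap p q r : det3 p r q = - det3 p q r.
Proof. by rewrite /det3; ring. Qed.

(** A line meets the circle in at most two points. *)
Lemma det3_neq0 p q r : p <> q -> p <> r -> q <> r -> det3 p q r != 0.
Proof.
move=> pq pr qr; apply/eqP => d0.
have hp := circleE p; have hq := circleE q; have hr := circleE r.
have neq (p' q' : T) : p' <> q' -> (tx q' - tx p') ^+ 2 + (ty q' - ty p') ^+ 2 != 0.
  move=> n; apply/eqP => /eqP; rewrite paddr_eq0 ?sqr_ge0 // !sqrf_eq0 !subr_eq0.
  by move=> /andP[/eqP e1 /eqP e2]; apply: n; apply: circle_eq.
have nq := neq _ _ pq; have nr := neq _ _ pr.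
move: d0; rewrite /det3.
set u1 := tx q - tx p; set u2 := ty q - ty p.
set v1 := tx r - tx p; set v2 := ty r - ty p => d0.
rewrite -/u1 -/u2 in nq; rewrite -/v1 -/v2 in nr.
have eu : 2 * (tx p * u1 + ty p * u2) + (u1 ^+ 2 + u2 ^+ 2) = 0.
  by rewrite /u1 /u2; lra.
have ev : 2 * (tx p * v1 + ty p * v2) + (v1 ^+ 2 + v2 ^+ 2) = 0.
  by rewrite /v1 /v2; lra.
pose U := u1 ^+ 2 + u2 ^+ 2; pose V := v1 ^+ 2 + v2 ^+ 2.
rewrite -/U in eu nq; rewrite -/V in ev nr.
(* Inversion at [p] sends the circle to a line, so parallel chords [u] and [v] satisfy [U v = V u];
   comparing norms then gives [U = V], hence [u = v]. *)
have e1 : U * v1 = V * u1.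
  have : (U * v1 - V * u1) = 2 * ty p * (u1 * v2 - u2 * v1) +
    (2 * (tx p * u1 + ty p * u2) + U) * v1 - (2 * (tx p * v1 + ty p * v2) + V) * u1 by ring.
  by rewrite d0 eu ev mulr0 !mul0r oppr0 !addr0 => /eqP; rewrite subr_eq0 => /eqP.
have e2 : U * v2 = V * u2.
  have : (U * v2 - V * u2) = - (2 * tx p * (u1 * v2 - u2 * v1)) +
    (2 * (tx p * u1 + ty p * u2) + U) * v2 - (2 * (tx p * v1 + ty p * v2) + V) * u2 by ring.
  by rewrite d0 eu ev mulr0 !mul0r !oppr0 !addr0 => /eqP; rewrite subr_eq0 => /eqP.
have UV : U = V.
  have : (U * V) * (U - V) = 0.
    have -> : (U * V) * (U - V) = (U * v1) ^+ 2 + (U * v2) ^+ 2 - U * V ^+ 2 by rewrite /V; ring.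
    by rewrite e1 e2 /U; ring.
  by move=> /eqP; rewrite !mulf_eq0 (negbTE nq) (negbTE nr) /= subr_eq0 => /eqP.
apply: qr; rewrite UV in e1 e2.
have := mulfI nr e1; have := mulfI nr e2; rewrite /u1 /u2 /v1 /v2 => h2 h1.
by apply: circle_eq; lra.
Qed.

(** The sample points have coordinates [0] and [1] or [-1], so isometries give exactly [2] or
    [-2]. *)
Definition orient3 (f : T -> T) : R := det3 (f (ept 0)) (f (ept (1 / 4))) (f (ept (3 / 4))).

Definition orev (f : T -> T) : bool := orient3 f < 0.

Lemma ept0E : tx (ept 0 : T) = 1 /\ ty (ept 0 : T) = 0.
Proof. by rewrite /ept /tx /ty /= mulr0 cos0 sin0. Qed.

Lemma ept14E : tx (ept (1 / 4) : T) = 0 /\ ty (ept (1 / 4) : T) = 1.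
Proof.
rewrite /ept /tx /ty /=.
have -> : 2 * pi * (1 / 4) = pi / 2 :> R by field.
by rewrite cos_pihalf sin_pihalf.
Qed.

Lemma ept34E : tx (ept (3 / 4) : T) = 0 /\ ty (ept (3 / 4) : T) = - 1.
Proof.
rewrite /ept /tx /ty /=.
have -> : 2 * pi * (3 / 4) = pi + pi / 2 :> R by field.
by rewrite cosDpihalf sinDpihalf sinpi cospi oppr0.
Qed.

Lemma orient3_isoT t e : orient3 (isoT t e) = if e then - 2 else 2.
Proof.
have := cos2Dsin2 (2 * pi * t).
rewrite /orient3 /det3 !tx_isoT !ty_isoT.
have [-> ->] := ept0E; have [-> ->] := ept14E; have [-> ->] := ept34E.
set c := cos _; set s := sin _ => h.
by case: e; rewrite /=; lra.
Qed.

Lemma orev_isoT t e : orev (isoT t e) = e.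
Proof. by rewrite /orev orient3_isoT; case: e; lra. Qed.

Lemma orient_orev (X : Type) (phi : X -> T -> T) x : isomT (phi x) ->
  orient phi x = orev (phi x).
Proof.
move=> /isomTP[t [e pE]]; rewrite /orient pE orev_isoT.
case: e {pE}.
  apply/negP => /asboolP[t' rt'].
  have : isoT t true = isoT t' false.
    by apply/funext => p; apply: val_inj; rewrite [val _]rt'.
  by move=> h; have := orev_isoT t true; rewrite h orev_isoT.
by apply/negbTE; rewrite negbK; apply/asboolP; exists t => p.
Qed.

Lemma continuous_det3 (S : topologicalType) (f g h : S -> T) :
  continuous f -> continuous g -> continuous h ->
  continuous (fun s => det3 (f s) (g s) (h s)).
Proof.
move=> cf cg ch.
have cx (k : S -> T) : continuous k -> continuous (fun s => tx (k s)).
  by move=> ck s; apply: continuous_comp; [exact: ck | exact: continuous_tx].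
have cy (k : S -> T) : continuous k -> continuous (fun s => ty (k s)).
  by move=> ck s; apply: continuous_comp; [exact: ck | exact: continuous_ty].
apply: continuous_realB; apply: continuous_realM; apply: continuous_realB;
  by [exact: cx | exact: cy].
Qed.

Lemma nonvanishing_sign (G : R -> R) : continuous G ->
  (forall u, 0 <= u <= 1 -> G u != 0) -> 0 < G 0 * G 1.
Proof.
move=> cG nG; rewrite ltNge; apply/negP => le0.
have [||u u01 Gu] := @IVT R G 0 1 0 ler01.
- exact: continuous_subspaceT.
- rewrite ge_min le_max; case: (leP (G 0) 0) => h0; case: (leP (G 1) 0) => h1 /=;
    rewrite ?orbT ?orbF //; nra.
- by have /eqP := nG u u01.
Qed.

(** The angles with [a < b < c < a + 1] form a convex set: the segment to the sample angles stays in
    it, and the determinant cannot vanish along the way. *)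
Lemma orient3_const (f : T -> T) (a b c : R) : continuous f -> injective f ->
  a < b -> b < c -> c < a + 1 ->
  0 < det3 (f (ept a)) (f (ept b)) (f (ept c)) * orient3 f.
Proof.
move=> cf fi ab bc ca.
pose l (x y u : R) := x + u * (y - x).
have cl x y : continuous (l x y).
  apply: continuous_realD; first exact: continuous_realC.
  apply: continuous_realM; last exact: continuous_realC.
  by move=> u; exact: cvg_id.
have cfl x y : continuous (fun u => f (ept (l x y u))).
  move=> u; apply: (@continuous_comp _ _ _ (fun u => ept (l x y u)) f); last exact: cf.
  by apply: continuous_comp; [exact: cl | exact: continuous_ept].
have := @nonvanishing_sign (fun u => det3 (f (ept (l a 0 u))) (f (ept (l b (1 / 4) u)))
  (f (ept (l c (3 / 4) u)))).
have l0 x y : l x y 0 = x by rewrite /l; ring.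
have l1 x y : l x y 1 = y by rewrite /l; ring.
rewrite !l0 !l1; apply.
  exact: continuous_det3.
move=> u /andP[u0 u1].
have lt1 : l a 0 u < l b (1 / 4) u by rewrite /l; nra.
have lt2 : l b (1 / 4) u < l c (3 / 4) u by rewrite /l; nra.
have lt3 : l c (3 / 4) u < l a 0 u + 1 by rewrite /l; nra.
by apply: det3_neq0 => /fi; apply: ept_neq; lra.
Qed.

Lemma det3_ept_gt0 a b c : a < b -> b < c -> c < a + 1 ->
  0 < det3 (ept a) (ept b) (ept c).
Proof.
move=> ab bc ca; have := @orient3_const id a b c _ _ ab bc ca.
have -> : orient3 id = 2.
  by rewrite -(orient3_isoT 0 false); congr orient3; apply/funext => p; rewrite isoT0.
by move=> h; have := h (fun=> cvg_id) (fun _ _ => id); nra.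
Qed.

Lemma orient3_neq0 (f : T -> T) : injective f -> orient3 f != 0.
Proof.
move=> fi; apply: det3_neq0 => /fi; apply: ept_neq; lra.
Qed.

(** Lift the three sample images under [h] to angles in one turn starting at [a]. The order of the
    other two is the orientation of [h], and [orient3_const] compares their images under [f] with
    [orient3 f]. *)
Lemma orev_comp (f h : T -> T) : continuous f -> injective f -> injective h ->
  orev (f \o h) = orev f (+) orev h.
Proof.
move=> cf fi hi; rewrite /orev.
have fn := orient3_neq0 fi; have hn := orient3_neq0 hi.
have [a ha] := ept_surj (h (ept 0)).
have [b [ab ba hb]] := ept_surj_from a (h (ept (1 / 4))).
have [c [ac ca hc]] := ept_surj_from a (h (ept (3 / 4))).
have ab' : a != b.
  apply/eqP => e; have : h (ept 0) = h (ept (1 / 4)) by rewrite -ha -hb e.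
  by move/hi; apply: ept_neq; lra.
have ac' : a != c.
  apply/eqP => e; have : h (ept 0) = h (ept (3 / 4)) by rewrite -ha -hc e.
  by move/hi; apply: ept_neq; lra.
have [bc|cb|bc] := ltgtP b c; last first.
- exfalso; have : h (ept (1 / 4)) = h (ept (3 / 4)) by rewrite -hb -hc bc.
  by move/hi; apply: ept_neq; lra.
- have cpos : a < c by rewrite lt_neqAle ac' ac.
  have h1 := det3_ept_gt0 cpos cb ba.
  have h2 := orient3_const cf fi cpos cb ba.
  have -> : orient3 h < 0 by rewrite /orient3 -ha -hb -hc det3_swap; lra.
  rewrite {1}/orient3 /= -ha -hb -hc det3_swap addbT.
  by have [f0|f0] := ltP (orient3 f) 0; nra.
- have bpos : a < b by rewrite lt_neqAle ab' ab.
  have h1 := det3_ept_gt0 bpos bc ca.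
  have h2 := orient3_const cf fi bpos bc ca.
  have -> : (orient3 h < 0) = false by rewrite /orient3 -ha -hb -hc; lra.
  rewrite {1}/orient3 /= -ha -hb -hc addbF.
  by have [f0|f0] := ltP (orient3 f) 0; nra.
Qed.

Lemma orev_locconst (X : topologicalType) (g : X -> T -> T) :
  (forall p, continuous (fun x => g x p)) -> (forall x, injective (g x)) ->
  locconst (fun x => orev (g x)).
Proof.
move=> cg gi x.
have cD : continuous (fun x => orient3 (g x)) by apply: continuous_det3.
have nD := orient3_neq0 (gi x).
have [D0|D0] := boolP (orev (g x)).
  have {}D0 : orient3 (g x) < 0 by [].
  have : nbhs x [set y | orient3 (g y) < 0].
    by apply: (cD x [set r | r < 0]); apply: open_nbhs_nbhs; split; [exact: open_lt | ].
  by apply: filterS => y; rewrite /= /orev => ->.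
have {}D0 : 0 < orient3 (g x) by move: D0; rewrite /orev -leNgt lt_neqAle eq_sym nD.
have : nbhs x [set y | 0 < orient3 (g y)].
  by apply: (cD x [set r | 0 < r]); apply: open_nbhs_nbhs; split; [exact: open_gt | ].
by apply: filterS => y; rewrite /= /orev => h; apply/negbTE; rewrite -leNgt ltW.
Qed.

Lemma mul_close (A B A' B' : R) : -2 <= A <= 2 -> -2 <= B <= 2 ->
  `|A' - A| <= 1 / 50 -> `|B' - B| <= 1 / 50 -> `|A' * B' - A * B| <= 1 / 10.
Proof.
move=> /andP[A1 A2] /andP[B1 B2]; rewrite !ler_norml => /andP[a1 a2] /andP[b1 b2].
have -> : A' * B' - A * B = (A' - A) * B + A * (B' - B) + (A' - A) * (B' - B) by ring.
move: (A' - A) (B' - B) a1 a2 b1 b2 => x y a1 a2 b1 b2.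
have h1 : `|x * B| <= 1 / 25 by rewrite ler_norml; apply/andP; split; nra.
have h2 : `|A * y| <= 1 / 25 by rewrite ler_norml; apply/andP; split; nra.
have h3 : `|x * y| <= 1 / 50 by rewrite ler_norml; apply/andP; split; nra.
by move: h1 h2 h3; rewrite !ler_norml => /andP[? ?] /andP[? ?] /andP[? ?]; apply/andP; split; lra.
Qed.

(** Coordinate errors below [1/100] change each product in the determinant by at most [1/10], too
    little to change the sign of [2] or [-2]. *)
Lemma orev_close (f g : T -> T) (e : R) : e <= 1 / 100 -> isomT g ->
  (forall p, ball (g p) e (f p)) -> orev f = orev g.
Proof.
move=> e1 /isomTP[t [s gE]] fg.
have close p : `|tx (g p) - tx (f p)| < e /\ `|ty (g p) - ty (f p)| < e.
  by have [] := fg p.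
have bd (q : T) : (-1 <= tx q <= 1) /\ (-1 <= ty q <= 1).
  by have := circleE q; split; apply/andP; split; nra.
have dx p q : (-2 <= tx (g q) - tx (g p) <= 2) /\
    `|(tx (f q) - tx (f p)) - (tx (g q) - tx (g p))| <= 1 / 50.
  have [/andP[? ?] _] := bd (g p); have [/andP[? ?] _] := bd (g q).
  have [] := close p; have [] := close q; rewrite !ltr_norml.
  move=> /andP[? ?] _ /andP[? ?] _; split; first by apply/andP; split; lra.
  by rewrite ler_norml; apply/andP; split; lra.
have dy p q : (-2 <= ty (g q) - ty (g p) <= 2) /\
    `|(ty (f q) - ty (f p)) - (ty (g q) - ty (g p))| <= 1 / 50.
  have [_ /andP[? ?]] := bd (g p); have [_ /andP[? ?]] := bd (g q).
  have [_ +] := close p; have [_ +] := close q; rewrite !ltr_norml.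
  move=> /andP[? ?] /andP[? ?]; split; first by apply/andP; split; lra.
  by rewrite ler_norml; apply/andP; split; lra.
have [a1 a2] := dx (ept 0) (ept (1 / 4)); have [b1 b2] := dy (ept 0) (ept (3 / 4)).
have [c1 c2] := dy (ept 0) (ept (1 / 4)); have [d1 d2] := dx (ept 0) (ept (3 / 4)).
have := mul_close a1 b1 a2 b2; have := mul_close c1 d1 c2 d2; rewrite !ler_norml.
move=> /andP[? ?] /andP[? ?].
have := orient3_isoT t s; rewrite -gE /orev /orient3 /det3.
by case: s {gE} => h; rewrite h; lra.
Qed.

End Orientation.

(** * From the circle bundle to the base *)

(** A Lebesgue number for the cover by sets of constancy. *)
Lemma locconst_uniform (R : realType) (Y : pseudoMetricType R) (V : Type) (F : Y -> V) :
  compact [set: Y] -> locconst F ->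
  exists2 e : R, 0 < e & forall y y', ball y e y' -> F y' = F y.
Proof.
move=> cY lF.
pose P (e : R) (y : Y) := forall y', ball y e y' -> F y' = F y.
have PF : ProperFilter (0^'+ : set_system R) by exact: at_right_proper_filter.
have hP : \forall e \near 0^'+, [set: Y] `<=` P e.
  apply: ((iffLR (compact_near_coveringP _) cY) R _ P _) => y _.
  have /nbhs_ballP[e /= e0 he] := lF y.
  exists (ball y (e / 2), [set i | i <= e / 2]).
    by split; [apply: nbhsx_ballx; exact: divr_gt0 | apply: nbhs_right_le; exact: divr_gt0].
  move=> [y' i] /= [yy' ie] z y'z.
  have -> : F y' = F y by apply: he; apply: le_ball yy'; lra.
  apply: he; rewrite [e]splitr; apply: ball_triangle yy' _.
  exact: le_ball y'z.
have [e [he e0]] := filter_ex (filterI hP (nbhs_right_gt 0)).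
by exists e => // y; exact: (he y I).
Qed.

Lemma uniform_cvg_ball (R : realType) (U : choiceType) (V : pseudoMetricType R)
    (I : Type) (G : set_system I) {GG : Filter G} (f_ : I -> U -> V) (f : U -> V) :
  {uniform, f_ @ G --> f} <->
  forall e : R, 0 < e -> \forall i \near G, forall u, ball (f u) e (f_ i u).
Proof.
split=> [cf e e0|h].
  have : nbhs (f : {uniform U -> V}) [set g | forall u, ball (f u) e (g u)].
    apply/uniform_nbhs; exists [set xy | ball xy.1 e xy.2]; split.
      by rewrite -entourage_ballE; exists e.
    by move=> g /= gE u; exact: gE.
  by move/cf.
move=> P /uniform_nbhs[E [entE EP]].
move: entE; rewrite -entourage_ballE => -[e e0 eE].
apply: filterS (h e e0) => i hi; apply: EP => u _.
exact: (eE (f u, f_ i u) (hi u)).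
Qed.

Section Necessity.
Variable R : realType.
Notation T := (Tcirc R).

(** A separating clopen set would pull back along [ept] to a proper nonempty clopen subset of the
    line. *)
Lemma circle_connected (Y : topologicalType) (g : T -> Y) : zero_dimensional Y ->
  continuous g -> forall p q, g p = g q.
Proof.
move=> zY cg p q; apply: contrapT => /eqP /zY[U [cU Up Uq]].
have [u ue] := ept_surj p; have [v ve] := ept_surj q.
pose B := [set w : R | U (g (ept w))].
have cB : clopen B.
  apply: (@preimage_clopen _ _ (fun w => g (ept w))) => // w.
  by apply: continuous_comp; [exact: continuous_ept | exact: cg].
have BT : B = setT.
  have cR : connected [set: R] by apply/connected_intervalP.
  apply: cR; first by exists u; rewrite /B /= ue.
    by exists B; rewrite ?setTI //; case: cB.
  by exists B; rewrite ?setTI //; case: cB.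
by apply: Uq; rewrite -ve; have : B v by rewrite BT.
Qed.

Lemma isomT_continuous (f : T -> T) : isomT f -> continuous f.
Proof. by move=> /isomTP[t [e ->]]; exact: continuous_isoT. Qed.

Lemma isomT_inj (f : T -> T) : isomT f -> injective f.
Proof. by move=> /isomTP[t [e ->]]; exact: can_inj (isoTK t e). Qed.

Lemma orient_locconst (X : pseudoMetricType R) (phi : X -> T -> T) :
  (forall x, isomT (phi x)) ->
  (forall x : X, {uniform, phi x' @[x' --> x] --> phi x}) -> locconst (orient phi).
Proof.
move=> iphi cphi.
have -> : orient phi = (fun x => orev (phi x)).
  by apply/funext => x; apply: orient_orev.
have cp (p : T) (x : X) : phi x' p @[x' --> x] --> phi x p.
  move=> N /nbhs_ballP[e /= e0 eN].
  have h := (@uniform_cvg_ball R _ _ _ (nbhs x) (nbhs_filter x) phi (phi x)).1 (cphi x) e e0.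
  have : nbhs x [set x' | N (phi x' p)] by apply: filterS h => x' hx; exact: (eN _ (hx p)).
  by [].
apply: orev_locconst => [p x|x]; [exact: cp | exact: isomT_inj].
Qed.

Lemma circle_conj_base (X Y : pseudoMetricType R) (a ai : X -> X) (b bi : Y -> Y)
    (phi : X -> T -> T) (psi : Y -> T -> T)
    (s : nat -> X * T -> Y * T) (si : nat -> Y * T -> X * T) :
  cantor_minimal a ai -> cantor_minimal b bi ->
  (forall x, isomT (phi x)) -> (forall y, isomT (psi y)) ->
  (forall n, homeo_pair (s n) (si n)) ->
  {uniform, (fun n z => s n (skewprod a phi (si n z))) @ \oo --> skewprod b psi} ->
  approx_conj a b (orient phi) (orient psi).
Proof.
move=> mX mY iphi ipsi hs cs V F lF.
have zX : zero_dimensional X by case: mX => -[[]].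
have zY : zero_dimensional Y by case: mY => -[[]].
have kY : compact [set: Y] by case: mY => -[[]].
have [e1 e10 Fe] := locconst_uniform kY lF.
(* [e1] controls the values of [F] on the base, [1/100] the orientation in the fibres. *)
pose e := Num.min e1 (1 / 100).
have e0 : 0 < e by rewrite lt_min e10 /=; lra.
have [n hn] := filter_ex ((@uniform_cvg_ball R _ _ _ \oo _ _ _).1 cs e e0).
have {cs} close z : ball (b z.1, psi z.1 z.2) e (s n (skewprod a phi (si n z))) := hn z.
have [cS cSi SK SiK] := hs n.
pose S := s n; pose Si := si n.
pose p0 : T := ept 0.
have cpair (A : topologicalType) (x : A) : continuous (fun p : T => (x, p)).
  apply: (@continuous_pair _ _ _ (fun=> x) id); first exact: cst_continuous.
  by move=> ?; exact: cvg_id.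
have cpairl (A : topologicalType) (p : T) : continuous (fun x : A => (x, p)).
  apply: (@continuous_pair _ _ _ id (fun=> p)); first by move=> ?; exact: cvg_id.
  exact: cst_continuous.
have cpt (A B C : topologicalType) (f : A -> B) (g : B -> C) :
    continuous f -> continuous g -> continuous (fun x => g (f x)).
  by move=> cf cg x; apply: continuous_comp; [exact: cf | exact: cg].
have cfst (A B : topologicalType) : continuous (@fst A B) by move=> ?; exact: cvg_fst.
have csnd (A B : topologicalType) : continuous (@snd A B) by move=> ?; exact: cvg_snd.
have cSp x : continuous (fun p => S (x, p)) by exact: (cpt _ _ _ _ S (cpair _ x) cS).
have cSip y : continuous (fun p => Si (y, p)) by exact: (cpt _ _ _ _ Si (cpair _ y) cSi).
have cSx p : continuous (fun x => S (x, p)) by exact: (cpt _ _ _ _ S (cpairl _ p) cS).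
have cSix p : continuous (fun y => Si (y, p)) by exact: (cpt _ _ _ _ Si (cpairl _ p) cSi).
pose t x := (S (x, p0)).1; pose ti y := (Si (y, p0)).1.
have tE x p : (S (x, p)).1 = t x.
  exact: (@circle_connected Y (fun p => (S (x, p)).1) zY (cpt _ _ _ _ _ (cSp x) (cfst _ _))).
have tiE y p : (Si (y, p)).1 = ti y.
  exact: (@circle_connected X (fun p => (Si (y, p)).1) zX (cpt _ _ _ _ _ (cSip y) (cfst _ _))).
pose g x p := (S (x, p)).2; pose k y p := (Si (y, p)).2.
have SE x p : S (x, p) = (t x, g x p) by rewrite -(tE x p) -surjective_pairing.
have SiE y p : Si (y, p) = (ti y, k y p) by rewrite -(tiE y p) -surjective_pairing.
have tK x : ti (t x) = x /\ cancel (g x) (k (t x)).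
  have h p : Si (S (x, p)) = (x, p) by exact: SK.
  split=> [|p]; first by have := h p0; rewrite SE SiE => -[].
  by have := h p; rewrite SE SiE => -[].
have tiK y : t (ti y) = y /\ cancel (k y) (g (ti y)).
  have h p : S (Si (y, p)) = (y, p) by exact: SiK.
  split=> [|p]; first by have := h p0; rewrite SiE SE => -[].
  by have := h p; rewrite SiE SE => -[].
have gi x : injective (g x) by exact: can_inj (tK x).2.
have ki y : injective (k y) by exact: can_inj (tiK y).2.
have cg x : continuous (g x) by exact: (cpt _ _ _ _ snd (cSp x) (csnd _ _)).
exists t, ti, (fun x => orev (g x)); split.
- split; first exact: (cpt _ _ _ _ fst (cSx p0) (cfst _ _)).
  + exact: (cpt _ _ _ _ fst (cSix p0) (cfst _ _)).
  + by move=> x; have [] := tK x.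
  + by move=> y; have [] := tiK y.
- apply: orev_locconst => // p; exact: (cpt _ _ _ _ snd (cSx p) (csnd _ _)).
- move=> x; have := close (S (x, p0)); rewrite SK /skewprod /= -/S !SE /= => -[h _].
  apply/esym; apply: Fe; apply: le_ball h.
  by rewrite ge_min lexx.
- move=> x.
  have kE : orev (k (t x)) = orev (g x).
    have : orev (g x \o k (t x)) = false.
      rewrite -[RHS](@orev_isoT R 0 false); congr orev; apply/funext => p /=.
      by rewrite isoT0; have := (tiK (t x)).2 p; rewrite (tK x).1.
    by rewrite orev_comp //; case: (orev (g x)); case: (orev _).
  (* The fibre map over [t x] of the conjugated system; it is close to [psi (t x)] and so has the
     same orientation. *)
  pose f := g (a x) \o (phi x \o k (t x)).
  have fE : orev f = orev (psi (t x)).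
    apply: (@orev_close _ _ _ e) => //; first by rewrite ge_min lexx orbT.
    move=> p; have := close (t x, p); rewrite -/Si -/S SiE (tK x).1 /skewprod /= SE => -[_ h].
    exact: h.
  have ii : injective (phi x \o k (t x)) by apply: inj_comp => //; exact: isomT_inj.
  move: fE; rewrite /f orev_comp // orev_comp //; last 2 first.
  - exact: isomT_continuous.
  - exact: isomT_inj.
  rewrite kE !orient_orev // => <-.
  by case: (orev (g x)); case: (orev _); case: (orev _).
Qed.

End Necessity.

(** * From the base to the circle bundle *)

(** [F] is the endpoint without corrections; one unit of freedom per step, whatever the reflections,
    reaches every integer within [l] of it. *)
Lemma drift_walk (sg : nat -> bool) (m : nat -> int) (l : nat) :
  exists F : int, forall n : int, `|n| <= l%:Z -> exists p : nat -> int,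
    [/\ p 0%N = 0, p l = F + n & forall i, (i < l)%N -> exists2 c : int,
      `|c| <= 1 & p i.+1 = (if sg i then - p i else p i) + m i + c].
Proof.
elim: l => [|l [F IH]].
  by exists 0 => n n0; exists (fun=> 0); split => //; lia.
exists ((if sg l then - F else F) + m l) => n nl.
(* The last step makes one unit of the correction; the rest, with its sign changed if that step
   reflects, is left to the earlier ones. *)
pose c : int := if 0 < n then 1 else if n < 0 then -1 else 0.
have [|p [p0 pl pE]] := IH (if sg l then - (n - c) else n - c).
  by rewrite /c; case: (sg l); case: ifP; [|case: ifP| |case: ifP]; lia.
exists (fun i => if (i <= l)%N then p i else (if sg l then - F else F) + m l + n).
split => //; first by rewrite ltnn.
move=> i; rewrite ltnS => il; rewrite il; move: (il); rewrite leq_eqVlt => /orP[/eqP e|il'].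
  rewrite e ltnn; exists c; first by rewrite /c; case: ifP; [|case: ifP]; lia.
  by rewrite pl; case: (sg l); ring.
by rewrite il'; exact: pE.
Qed.

(* Towers of height at least [N] leave room for correcting any residue modulo
   [N] one unit at a time. *)
Lemma approx_coboundary (X : topologicalType) (a ai : X -> X) (sg : X -> bool)
    (m : X -> int) (N : nat) :
  cantor_minimal a ai -> locconst sg -> locconst m -> (0 < N)%N ->
  exists r : X -> int, locconst r /\ forall x, exists c k : int,
    `|c| <= 1 /\ r (a x) = (if sg x then - r x else r x) + m x + c + k * N%:Z.
Proof.
move=> mX lsg lm N0.
have [_ [x0 _]] : cantor_set X by case: mX.
have ca : continuous a by case: mX => _ [].
have [W [cW Wx0 _ WN]] := small_base mX N x0 (@locconst_cst X _ tt).
have W0 : W !=set0 by exists x0.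
pose Good (x : X) (l : nat) (p : nat -> int) := (p 0%N = 0 /\ p l = 0) /\
  forall i, (i < l)%N -> exists c k : int, `|c| <= 1 /\
    p i.+1 = (if sg (iter i a x) then - p i else p i) + m (iter i a x) + c + k * N%:Z.
have [||r [lr rP]] := @tower_select X a ai mX W cW W0 _ 0 Good.
- by move=> x l p [].
- move=> x l Wx [l0 Wl _].
  have Nl : (N <= l)%N.
    by rewrite leqNgt; apply/negP => lN; apply: (WN x l) => //; rewrite l0.
  have [F hF] := drift_walk (fun i => sg (iter i a x)) (fun i => m (iter i a x)) l.
  (* This correction lies between [0] and [N - 1] and makes the endpoint a multiple of [N]; [p']
     resets it to [0], and the multiple goes into [k]. *)
  have [|p [p0 pl pE]] := hF (- F %% N%:Z)%Z.
    have := modz_ge0 (- F) (_ : N%:Z != 0); have := ltz_mod (- F) (_ : N%:Z != 0); lia.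
  pose p' i := if (i < l)%N then p i else 0.
  exists p'.
  have := @locconst_all X _ l (fun i x => (sg (iter i a x), m (iter i a x))) _ x.
  move=> h; have {}h := h (fun i => locconst_comp (@continuous_iter _ _ ca i) (locconst_pair lsg lm)).
  apply: filterS h => y h; split.
    by rewrite /p' l0 ltnn.
  move=> i il; have [-> ->] := h i il; have [c c1 pc] := pE i il.
  rewrite {2 3}/p' il /p'; have [il1|il1] := ltnP i.+1 l.
    by exists c, 0; split => //; rewrite mul0r addr0.
  have e : i.+1 = l by apply/eqP; rewrite eqn_leq il1 il.
  exists c, ((- F %/ N%:Z)%Z); split => //.
  by rewrite -pc e pl -addrA [(_ %% _)%Z + _]addrC -divz_eq subrr.
exists r; split => // z.
have [x [l [i [Wx rl il zE]]]] := tower_cover mX cW W0 z.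
have [p [[_ pE] rE]] := rP x l Wx rl.
by rewrite zE -iterS !rE //; [exact: pE | exact: ltnW].
Qed.

Section Sufficiency.
Variable R : realType.
Notation T := (Tcirc R).

Lemma circle_ball (p q : T) (e : R) :
  `|tx p - tx q| < e -> `|ty p - ty q| < e -> ball p e q.
Proof. by move=> h1 h2; split. Qed.

Lemma circle_ballE (p q : T) (e : R) :
  ball p e q -> `|tx p - tx q| < e /\ `|ty p - ty q| < e.
Proof. by move=> []. Qed.

Lemma circle_bound (q : T) : `|tx q| <= 1 /\ `|ty q| <= 1.
Proof. by have := circleE q; split; rewrite ler_norml; apply/andP; split; nra. Qed.

Lemma small_rotation (e : R) : 0 < e ->
  exists2 d : R, 0 < d & forall u, `|u| < d -> forall p : T, ball p e (isoT u false p).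
Proof.
move=> e0; have e20 : 0 < e / 2 by lra.
have c0 : {for 0, continuous (fun u : R => tx (ept u : T))}.
  by apply: continuous_comp; [exact: continuous_ept | exact: continuous_tx].
have s0 : {for 0, continuous (fun u : R => ty (ept u : T))}.
  by apply: continuous_comp; [exact: continuous_ept | exact: continuous_ty].
have [x0 y0] := @ept0E R.
have hc : \forall u \near (0 : R), `|1 - tx (ept u : T)| < e / 2.
  by have /cvgrPdist_lt /(_ _ e20) := c0; rewrite x0.
have hs : \forall u \near (0 : R), `|0 - ty (ept u : T)| < e / 2.
  by have /cvgrPdist_lt /(_ _ e20) := s0; rewrite y0.
have [d /= d0 hd] := (nbhs_ballP _ _).1 (filterI hc hs).
exists d => // u ud p; have [] := hd u.
  by rewrite /ball /= sub0r normrN.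
rewrite /= sub0r normrN; set C := tx (ept u); set S := ty (ept u) => hC hS.
have [bx by_] := circle_bound p.
apply: circle_ball; rewrite ?tx_isoT ?ty_isoT.
  rewrite -[cos _]/C -[sin _]/S.
  have -> : tx p - (C * tx p - S * ty p) = (1 - C) * tx p + S * ty p by ring.
  apply: le_lt_trans (ler_normD _ _) _; rewrite !normrM.
  by have := normr_ge0 (1 - C); have := normr_ge0 S; nra.
rewrite -[cos _]/C -[sin _]/S.
have -> : ty p - (S * tx p + C * ty p) = (1 - C) * ty p - S * tx p by ring.
apply: le_lt_trans (ler_normB _ _) _; rewrite !normrM.
by have := normr_ge0 (1 - C); have := normr_ge0 S; nra.
Qed.

(** Balls are those of the maximum norm, for which a rotation is not isometric; the factor two is a
    crude bound. *)
Lemma isoT_lipschitz t s (p q : T) (e : R) : ball p e q ->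
  ball (isoT t s p) (e + e) (isoT t s q).
Proof.
move=> /circle_ballE[h1 h2].
have [] := circle_bound (ept t); rewrite /tx /ty /=.
have n1 := normr_ge0 (tx p - tx q); have n2 := normr_ge0 (ty p - ty q).
have h2' : `|(if s then - ty p else ty p) - (if s then - ty q else ty q)| < e.
  by case: s => //; rewrite -opprD normrN.
have n2' := normr_ge0 ((if s then - ty p else ty p) - (if s then - ty q else ty q)).
set c := cos _; set d := sin _ => hc hd.
apply: circle_ball; rewrite ?tx_isoT ?ty_isoT -/c -/d.
  have -> : c * tx p - d * (if s then - ty p else ty p) -
    (c * tx q - d * (if s then - ty q else ty q)) = c * (tx p - tx q) -
    d * ((if s then - ty p else ty p) - (if s then - ty q else ty q)) by ring.
  apply: le_lt_trans (ler_normB _ _) _; rewrite !normrM; nra.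
have -> : d * tx p + c * (if s then - ty p else ty p) -
  (d * tx q + c * (if s then - ty q else ty q)) = d * (tx p - tx q) +
  c * ((if s then - ty p else ty p) - (if s then - ty q else ty q)) by ring.
apply: le_lt_trans (ler_normD _ _) _; rewrite !normrM; nra.
Qed.

Lemma dihedral_approx (X : pseudoMetricType R) (phi : X -> T -> T) (e : R) (N : nat) :
  cantor_set X -> (forall x, isomT (phi x)) ->
  (forall x : X, {uniform, phi x' @[x' --> x] --> phi x}) -> 0 < e -> (0 < N)%N ->
  (forall u : R, 0 <= u -> u < N%:R^-1 -> forall p : T, ball p e (isoT u false p)) ->
  exists k : X -> int, locconst k /\ forall x p,
    ball (phi x p) (e + e) (isoT ((k x)%:~R / N%:R) (orient phi x) p).
Proof.
move=> [[_ kX hX zX] _] iphi cphi e0 N0 rot.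
apply: (@locconst_select X kX hX zX _ (fun x k => forall p,
  ball (phi x p) (e + e) (isoT (k%:~R / N%:R) (orient phi x) p))) => x.
have [t [s pE]] := isomTP (iphi x).
have oE : orient phi x = s by rewrite orient_orev // pE orev_isoT.
(* Rounding the angle down to a multiple of [1/N] costs one [e]; keeping the same [k] near [x] costs
   the other. *)
pose k := Num.floor (t * N%:R); exists k.
have h := (@uniform_cvg_ball R _ _ _ (nbhs x) (nbhs_filter x) phi (phi x)).1 (cphi x) e e0.
have ho := orient_locconst iphi cphi x.
apply: filterS2 h ho => x' hx' -> p; rewrite oE.
apply: (@ball_triangle _ _ (phi x p)); first exact: ball_sym.
have N0' : 0 < (N%:R : R) by rewrite ltr0n.
pose u := t - k%:~R / N%:R.
have tE : t = u + k%:~R / N%:R by rewrite /u subrK.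
have := isoT_comp u false (k%:~R / N%:R) s p; rewrite /= -tE pE => <-.
apply: ball_sym; apply: rot.
  by rewrite subr_ge0 ler_pdivrMr //; exact: floor_le.
have := floorD1_gt (t * N%:R); rewrite -/k intrD => hk.
have : t < (k%:~R + 1) / N%:R by rewrite ltr_pdivlMr.
by rewrite mulrDl mul1r /u; lra.
Qed.

Lemma locconst_act_continuous (X : topologicalType) (g : X -> T -> T) :
  locconst g -> (forall x, continuous (g x)) ->
  continuous (fun z : X * T => g z.1 z.2).
Proof.
move=> lg cg z; apply: (@continuous_near_eq _ _ (fun z' : X * T => g z.1 z'.2)).
  have cf : continuous (fst : X * T -> X) by move=> z'; exact: cvg_fst.
  have h := locconst_comp cf lg z.
  by apply: filterS h => z' /= ->.
by apply: continuous_comp; [exact: cvg_snd | exact: cg].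
Qed.

Variables (X Y : pseudoMetricType R) (a ai : X -> X) (b bi : Y -> Y).
Variables (phi : X -> T -> T) (psi : Y -> T -> T).
Hypotheses (mX : cantor_minimal a ai) (mY : cantor_minimal b bi).
Hypotheses (iphi : forall x, isomT (phi x)) (ipsi : forall y, isomT (psi y)).
Hypothesis cphi : forall x : X, {uniform, phi x' @[x' --> x] --> phi x}.
Hypothesis cpsi : forall y : Y, {uniform, psi y' @[y' --> y] --> psi y}.
Hypothesis conj : approx_conj a b (orient phi) (orient psi).

Lemma circle_conj_approx (e : R) : 0 < e ->
  exists (s : X * T -> Y * T) (si : Y * T -> X * T), homeo_pair s si /\
    forall z, ball (skewprod b psi z) e (s (skewprod a phi (si z))).
Proof.
(* In the fibre the errors add up to [2d] for [psi], [d] for the coboundary, and [4d] for [phi],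
   whose [2d] is doubled by [isoT_lipschitz]. *)
move=> e0; pose d := e / 7; have d0 : 0 < d by rewrite /d; lra.
have [cX _ _] := mX; have [cY _ _] := mY.
have [w w0 rot] := small_rotation d0.
have [n hn] := ltr_add_invr w0; rewrite add0r in hn.
pose N := n.+1; have N0 : (0 < N)%N by [].
have N0' : 0 < (N%:R : R) by rewrite ltr0n.
have rot' (u : R) : 0 <= u -> u < N%:R^-1 -> forall p : T, ball p d (isoT u false p).
  by move=> u0 uN; apply: rot; rewrite ger0_norm //; exact: lt_trans uN hn.
have [kX [lkX kXE]] := dihedral_approx cX iphi cphi d0 N0 rot'.
have [kY [lkY kYE]] := dihedral_approx cY ipsi cpsi d0 N0 rot'.
(* A locally constant approximation of the identity of [Y]: respecting it makes [t] an approximate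
   conjugacy in the metric of [Y]. *)
have [c [lc cE]] : exists c : Y -> Y, locconst c /\ forall y, ball (c y) d y.
  case: cY => -[_ kk hh zz] _.
  apply: (@locconst_select Y kk hh zz _ (fun y c => ball c d y)) => y.
  by exists y; exact: nbhsx_ballx.
have [t [ti [h [tti lh tc ht]]]] := conj lc.
have [ct cti tK tiK] := tti.
have ca : continuous a by case: mX => _ [].
have loY := orient_locconst ipsi cpsi.
have lha : locconst (fun x => h (a x)) by exact: locconst_comp.
(* The angle, in units of [1/N], by which [r] must grow along [a] for the fibre isometries [rho] to
   intertwine the approximations of [phi] and [psi]. *)
have lm : locconst (fun x => kY (t x) - (if h (a x) then - kX x else kX x)).
  apply: (locconst_fun2 (fun u v : int => u - v)); first exact: locconst_comp.
  exact: (locconst_fun2 (fun (u : bool) (v : int) => if u then - v else v)).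
have [r [lr rE]] := approx_coboundary mX (locconst_comp ct loY) lm N0.
pose rho x := isoT ((r x)%:~R / N%:R : R) (h x).
pose rhoi x := isoTi ((r x)%:~R / N%:R : R) (h x).
have lrho : locconst rho.
  exact: (locconst_fun2 (fun (u : int) v => isoT (u%:~R / N%:R : R) v)).
have lrhoi : locconst (fun y => rhoi (ti y)).
  apply: (@locconst_comp _ _ _ ti rhoi) => //.
  exact: (locconst_fun2 (fun (u : int) v => isoTi (u%:~R / N%:R : R) v)).
have rhoK x : cancel (rho x) (rhoi x) by exact: isoTK.
have rhoiK x : cancel (rhoi x) (rho x) by exact: isoTiK.
exists (fun z => (t z.1, rho z.1 z.2)), (fun z => (ti z.1, rhoi (ti z.1) z.2)); split.
  split.
  - apply: (@continuous_pair _ _ _ (fun z : X * T => t z.1)).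
      by move=> z; apply: continuous_comp; [exact: cvg_fst | exact: ct].
    by apply: locconst_act_continuous => // x; exact: continuous_isoT.
  - apply: (@continuous_pair _ _ _ (fun z : Y * T => ti z.1)).
      by move=> z; apply: continuous_comp; [exact: cvg_fst | exact: cti].
    apply: (@locconst_act_continuous _ (fun y => rhoi (ti y))) => // x.
    exact: continuous_isoT.
  - by move=> [x p] /=; rewrite tK rhoK.
  - by move=> [y p] /=; rewrite tiK rhoiK.
move=> [y p]; rewrite /skewprod /=.
have [x ->] : exists x, y = t x by exists (ti y); rewrite tiK.
have [p' ->] : exists p', p = rho x p' by exists (rhoi x p); rewrite rhoiK.
rewrite tK rhoK.
split => /=.
  have h1 := cE (b (t x)); have h2 := cE (t (a x)); rewrite -tc in h2.
  by apply: le_ball (ball_triangle (ball_sym h1) h2); rewrite /d; lra.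
have q12 := kYE (t x) (rho x p').
have q34 := isoT_lipschitz ((r (a x))%:~R / N%:R) (h (a x)) (kXE x p').
(* By [ht] both composites have the same orientation, and their angles differ by [j/N] with
   [|j| <= 1], up to full turns. *)
have q23 : ball (isoT ((kY (t x))%:~R / N%:R) (orient psi (t x)) (rho x p')) d
    (rho (a x) (isoT ((kX x)%:~R / N%:R) (orient phi x) p')).
  rewrite /rho !isoT_comp ht.
  have [j [k [j1 rk]]] := rE x.
  set A := (kY _)%:~R / _ + _.
  have -> : (r (a x))%:~R / N%:R + (if h (a x) then - ((kX x)%:~R / N%:R) else
      (kX x)%:~R / N%:R) = j%:~R / N%:R + A + k%:~R :> R.
    have Nn0 : (N%:R : R) != 0 by rewrite gt_eqF.
    rewrite rk /A !intrD intrM; case: (orient psi _); case: (h (a x));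
      rewrite ?mulrNz ?opprK -?mulNr -!mulrDl; field; exact: Nn0.
  rewrite isoTDz -[_ (+) h x]/(false (+) _) -(isoT_comp (j%:~R / N%:R) false).
  apply: rot; rewrite normrM normfV (gtr0_norm N0') ltr_pdivrMr //.
  apply: (@le_lt_trans _ _ 1); first by rewrite -intr_norm lerz1.
  by move: hn; rewrite -ltr_pdivrMr // div1r.
apply: le_ball (ball_triangle (ball_triangle q12 q23) (ball_sym q34)).
by rewrite /d; lra.
Qed.

Lemma circle_conj_exists :
  exists (s : nat -> X * T -> Y * T) (si : nat -> Y * T -> X * T),
    (forall n, homeo_pair (s n) (si n)) /\
    {uniform, (fun n z => s n (skewprod a phi (si n z))) @ \oo --> skewprod b psi}.
Proof.
have /choice [S SP] : forall n : nat, exists ssi : (X * T -> Y * T) * (Y * T -> X * T),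
    homeo_pair ssi.1 ssi.2 /\
    forall z, ball (skewprod b psi z) n.+1%:R^-1 (ssi.1 (skewprod a phi (ssi.2 z))).
  move=> n; have [|s [si ssi]] := @circle_conj_approx n.+1%:R^-1.
    by rewrite invr_gt0 ltr0n.
  by exists (s, si).
exists (fun n => (S n).1), (fun n => (S n).2); split; first by move=> n; have [] := SP n.
apply/uniform_cvg_ball => e e0.
have := near_infty_natSinv_lt (PosNum e0); apply: filterS => n hn z.
by have [_ /(_ z)] := SP n; apply: le_ball; exact: ltW.
Qed.

End Sufficiency.

Theorem theorem4p9 (R : realType) (X Y : pseudoMetricType R)
  (a ai : X -> X) (b bi : Y -> Y)
  (phi : X -> Tcirc R -> Tcirc R) (psi : Y -> Tcirc R -> Tcirc R) :
  cantor_minimal a ai -> cantor_minimal b bi ->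
  (forall x, isomT (phi x)) -> (forall y, isomT (psi y)) ->
  (forall x : X, {uniform, phi x' @[x' --> x] --> phi x}) ->
  (forall y : Y, {uniform, psi y' @[y' --> y] --> psi y}) ->
  (exists (s : nat -> X * Tcirc R -> Y * Tcirc R) (si : nat -> Y * Tcirc R -> X * Tcirc R),
      (forall n, homeo_pair (s n) (si n)) /\
      {uniform, (fun n z => s n (skewprod a phi (si n z))) @ \oo --> skewprod b psi})
  <->
  (PS b `<=` PS a /\
   [\/ cob_bool bi (orient psi) /\ cob_bool ai (orient phi),
       ~ cob_bool bi (orient psi) /\
       (exists (n : nat) (f : X -> int) (g : Y -> int),
          [/\ (0 < n)%N, locconst f, locconst g,
              cob_int ai (fun x => 2 ^+ n.-1 * f x - 1) /\
              cob_bool ai (fun x => odd `|f x|%N (+) orient phi x) &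
              cob_int bi (fun y => 2 ^+ n.-1 * g y - 1) /\
              cob_bool bi (fun y => odd `|g y|%N (+) orient psi y)])
     | ~ cob_bool bi (orient psi) /\ PS (skewprod2 b psi) = PS b]).
Proof.
move=> mX mY iphi ipsi cphi cpsi.
have loX := orient_locconst iphi cphi; have loY := orient_locconst ipsi cpsi.
split.
  move=> [s [si [hs cs]]].
  have conj := circle_conj_base mX mY iphi ipsi hs cs.
  split; first exact: (approx_conj_PS mX mY conj).
  have [co|nco] := pselect (cob_bool bi (orient psi)).
    by apply: Or31; split => //; exact: (approx_conj_cob mX mY conj).
  have [e|ne] := pselect (PS (skewprod2 b psi) = PS b); first exact: Or33.
  by apply: Or32; split => //; exact: (approx_conj_half mX mY loY conj).
move=> [PSab cases]; apply: (circle_conj_exists mX mY) => //.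
case: cases => [[coY coX]|[nco [n [f [g [n0 lf lg [f1 f2] [g1 g2]]]]]]|[nco PSE]].
- exact: (approx_conj_trivial mX mY PSab coY coX).
- have pow2 : 2 ^+ n.-1 = (2 ^ n.-1)%N%:Z :> int by rewrite -natz natrX.
  rewrite pow2 in f1 g1.
  apply: (approx_conj_root mX mY loX loY PSab nco _ lf lg f1 f2 g1 g2).
  by rewrite expn_gt0.
- exact: (approx_conj_aperiodic mX mY loX loY PSab nco PSE).
Qed.
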